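(* Let $(M,g)$ be a screen transversal anti-invariant null submanifold of a normal indefinite complex contact manifold $\overline M$, and let $a\in\{1,2,3\}$. Then the screen distribution $S(TM)$ is integrable if and only if $\nabla^s_XJ_aY-\nabla^s_YJ_aX$ has no component in $J_a\mathrm{Rad}\,TM$ (with respect to the decomposition $S(TM^\perp)=\{J_a\mathrm{Rad}\,TM\oplus J_a\,l\mathrm{tr}(TM)\}\perp J_aS(TM)\perp D_0$) for all $X,Y\in\Gamma(S(TM))$.
   Context: **Ambient manifold.** $\overline{M}$ is a complex contact manifold of complex dimension $2n+1$ (real dimension $4n+2$): it has an open cover with holomorphic 1-forms $\theta_i$ satisfying $\theta_i\wedge(d\theta_i)^n\neq 0$ and $\theta_i=f_{ij}\theta_j$ on overlaps, $f_{ij}$ holomorphic and non-vanishing. $J$ is its complex structure, $\overline{g}$ a Hermitian semi-Riemannian metric of index $4q$, $0<q<n$, with Levi-Civita connection $\overline\nabla$. On each set of the cover there are 1-forms $u$, $v=u\circ J$ (with $\theta=u-iv$ up to a nonvanishing complex-valued function), orthogonal dual vector fields $U$ and $V=-JU$, and (1,1)-tensors $G$, $H=GJ$ with $G^2=H^2=-I+u\otimes U+v\otimes V$, $\overline g(GX,Y)=-\overline g(X,GY)$, $\overline g(U,X)=u(X)$, $GJ=-JG$, $GU=0$, $u(U)=1$; on overlaps $u'=au-bv$, $v'=bu+av$, $G'=aG-bH$, $H'=bG+aH$ with $a^2+b^2=1$. Moreover $du(X,Y)=\overline g(X,GY)+(\sigma\wedge v)(X,Y)$ and $dv(X,Y)=\overline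 g(X,HY)-(\sigma\wedge u)(X,Y)$, where $\sigma(X)=\overline g(\overline\nabla_XU,V)$. $\mathcal V=\mathrm{Span}\{U,V\}$ is the (global) characteristic subbundle, $\mathcal{H}=\mathcal V^\perp$ the horizontal one. $\overline M$ is *normal* if $S(X,Y)=T(X,Y)=0$ for $X,Y\in\Gamma(\mathcal H)$ and $S(U,X)=T(V,X)=0$ for all $X$, where, with $[\cdot,\cdot]$ of a tensor denoting its Nijenhuis tensor, $S(X,Y)=[G,G](X,Y)+2\overline g(X,GY)U-2\overline g(X,HY)V+2\{v(Y)HX-v(X)HY\}+\sigma(GY)HX-\sigma(GX)HY+\sigma(X)GHY-\sigma(Y)GHX$, $T(X,Y)=[H,H](X,Y)-2\overline g(X,GY)U+2\overline g(X,HY)V+2\{u(Y)GX-u(X)GY\}+\sigma(HX)GY-\sigma(HY)GX+\sigma(X)GHY-\sigma(Y)GHX$. (Conventions for $d$ and $\wedge$ are those for which, on a normal manifold, $\overline\nabla_XU=-GX+\sigma(X)V$ and $\overline\nabla_XV=-HX-\sigma(X)U$.) Put $J_1=J$, $J_2=G$, $J_3=H$. **Null submanifolds.** A submanifold $M$ of $\overline M$ with induced (degenerate) metric $g$ is *null* if $\mathrm{Rad}\,TM=TM\cap TM^\perp$ is a smooth distribution of constant rank $r>0$. Fix a screen distribution $S(TM)$ (nondegenerate, $TM=\mathrm{Rad}\,TM\perp S(TM)$), a screen transversal bundle $S(TM^\perp)$ (nondegenerate, $TM^\perp=\mathrm{Rad}\,TM\perp S(TM^\perp)$), and the null transversal bundle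 $l\mathrm{tr}(TM)$, locally spanned by null sections $N_i$ of the orthogonal complement of $S(TM^\perp)$ in $S(TM)^\perp$ with $\overline g(\xi_i,N_j)=\delta_{ij}$, $\overline g(N_i,N_j)=0$ for a local basis $\{\xi_i\}$ of $\mathrm{Rad}\,TM$. Then $T\overline M|_M=TM\oplus \mathrm{tr}(TM)$ with $\mathrm{tr}(TM)=l\mathrm{tr}(TM)\perp S(TM^\perp)$. For $X\in\Gamma(TM)$ and $W\in\Gamma(S(TM^\perp))$ write $\overline\nabla_XW=-A_WX+\nabla^s_XW+D^l(X,W)$ with $A_WX\in TM$, $\nabla^s_XW\in S(TM^\perp)$, $D^l(X,W)\in l\mathrm{tr}(TM)$. **Screen transversal anti-invariant null submanifold.** $\mathcal V\subset S(TM^\perp)$ along $M$, and $J_a\mathrm{Rad}\,TM\subset S(TM^\perp)$ and $J_aS(TM)\subset S(TM^\perp)$ for all $a=1,2,3$. For such $M$ the paper uses that also $J_a\,l\mathrm{tr}(TM)\subset S(TM^\perp)$ and $S(TM^\perp)=\{J_a\mathrm{Rad}\,TM\oplus J_a\,l\mathrm{tr}(TM)\}\perp J_aS(TM)\perp D_0$ with $D_0$ nondegenerate and $J_a$-invariant. *)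

(* Defs.v *)
(* MathComp / MathComp-Analysis, over an arbitrary [R : realType].

   The geometry is written in the classical component calculus.  A tensor field
   is a family of component functions indexed by the charts, subject to the
   tensor law on overlaps, and differential operators are evaluated in charts.

   Tangent vectors are ROW vectors, so linear maps act on the right:
     - the value at [x] of a (1,1)-tensor with matrix [F] is [x *m F], and the
       matrix of the composite "first [F], then [F']" is [F *m F'];
     - a 1-form is a column vector [w], with w(x) = x *m w;
     - a bilinear form is a square matrix [g], with g(x,y) = x *m g *m y^T;
     - a subspace is the row space of a matrix (mxalgebra).

   Component functions only matter on the domain of their chart. *)
From HB Require Import structures.
From mathcomp Require Import all_boot all_order all_algebra all_fingroup.
From mathcomp Require Import all_classical all_reals all_analysis.
From mathcomp Require Import complex.

Set Implicit Arguments.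
Unset Strict Implicit.
Unset Printing Implicit Defensive.

Import Order.TTheory GRing.Theory Num.Theory.
Import numFieldNormedType.Exports.

Local Open Scope classical_set_scope.
Local Open Scope ring_scope.

(** ** Linear algebra in one tangent space *)

Definition form_val (R : fieldType) m (g : 'M[R]_m) (x y : 'rV[R]_m) : R :=
  (x *m g *m y^T) 0 0.

Definition covec_val (R : fieldType) m (w : 'cV[R]_m) (x : 'rV[R]_m) : R :=
  (x *m w) 0 0.

Definition orth (R : fieldType) m s (g : 'M[R]_m) (A : 'M[R]_(s, m)) : 'M[R]_m :=
  kermx (g *m A^T).

Definition orthogonal_spaces (R : fieldType) m s t (g : 'M[R]_m)
    (A : 'M[R]_(s, m)) (B : 'M[R]_(t, m)) : Prop :=
  (A <= orth g B)%MS.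

Definition nondegenerate_on (R : fieldType) m s (g : 'M[R]_m)
    (A : 'M[R]_(s, m)) : Prop :=
  (A :&: orth g A)%MS = 0.

Definition negative_definite_on (R : realFieldType) m (g A : 'M[R]_m) : Prop :=
  forall x : 'rV[R]_m, (x <= A)%MS -> x != 0 -> form_val g x x < 0.

Definition has_index (R : realFieldType) m (g : 'M[R]_m) (nu : nat) : Prop :=
  (exists2 A : 'M[R]_m, \rank A = nu & negative_definite_on g A) /\
  (forall A : 'M[R]_m, negative_definite_on g A -> (\rank A <= nu)%N).

(* Multiplication by the imaginary unit on C^N = R^N x R^N, z = x + iy. *)
Definition stdJ (F : pzRingType) (N : nat) : 'M[F]_(N + N) :=
  block_mx 0 1%:M (- 1%:M) 0.

(** ** Smooth maps and smooth manifolds *)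

Fixpoint iter_derive (R : realType) m (V : normedModType R)
    (f : 'rV[R]_m -> V) (vs : seq 'rV[R]_m) : 'rV[R]_m -> V :=
  if vs is v :: vs' then iter_derive (fun x => 'D_v f x) vs' else f.

Definition smooth_on (R : realType) m (V : normedModType R)
    (D : set 'rV[R]_m) (f : 'rV[R]_m -> V) : Prop :=
  forall (vs : seq 'rV[R]_m) (x : 'rV[R]_m), D x ->
    differentiable (iter_derive f vs) x.

(* [chart_inv c] inverts [chart_coord c] on [chart_coord c @` chart_dom c];
   outside [chart_dom c] and its image both are arbitrary. *)
Record smoothManifold (R : realType) (m : nat) := SmoothManifold {
  man_pt :> topologicalType;
  man_hausdorff : hausdorff_space man_pt;
  man_second_countable : @second_countable man_pt;
  chart : Type;
  chart_dom : chart -> set man_pt;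
  chart_coord : chart -> man_pt -> 'rV[R]_m;
  chart_inv : chart -> 'rV[R]_m -> man_pt;
  dom_open : forall c, open (chart_dom c);
  dom_cover : forall p, exists c, chart_dom c p;
  range_open : forall c, open (chart_coord c @` chart_dom c);
  coordK : forall c p, chart_dom c p -> chart_inv c (chart_coord c p) = p;
  coord_continuous : forall c p, chart_dom c p ->
    {for p, continuous (chart_coord c)};
  point_continuous : forall c p, chart_dom c p ->
    {for chart_coord c p, continuous (chart_inv c)};
  transition_smooth : forall c d,
    smooth_on (chart_coord c @` (chart_dom c `&` chart_dom d))
      (chart_coord d \o chart_inv c)
}.
Arguments chart {R m} M : rename.
Arguments chart_dom {R m M} : rename.
Arguments chart_coord {R m M} : rename.
Arguments chart_inv {R m M} : rename.

(* Derivative at [p] of [F], along the vector with components [x] in chart [c]. *)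
Definition dir_derive (R : realType) m (M : smoothManifold R m)
    (V : normedModType R) (c : chart M) (x : 'rV[R]_m) (F : M -> V) (p : M) : V :=
  'D_x (F \o chart_inv c) (chart_coord c p).

Definition smooth_fun (R : realType) m (M : smoothManifold R m)
    (V : normedModType R) (O : set M) (F : M -> V) : Prop :=
  forall c : chart M,
    smooth_on (chart_coord c @` (O `&` chart_dom c)) (F \o chart_inv c).

Definition tangent_map (R : realType) k m (M : smoothManifold R k)
    (M' : smoothManifold R m) (f : M -> M') (e : chart M) (c : chart M') (p : M)
    : 'M[R]_(k, m) :=
  'J (chart_coord c \o f \o chart_inv e) (chart_coord e p).

Definition smooth_map (R : realType) k m (M : smoothManifold R k)
    (M' : smoothManifold R m) (f : M -> M') : Prop :=
  continuous f /\
  forall c : chart M', smooth_fun (f @^-1` chart_dom c) (chart_coord c \o f).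

(* Jacobian matrix of the change of coordinates from [c] to [d]. *)
Definition jac (R : realType) m (M : smoothManifold R m) (c d : chart M) (p : M)
    : 'M[R]_m :=
  tangent_map (fun q : M => q) c d p.

(** ** Tensor fields *)

Definition smooth_components (R : realType) k m (M : smoothManifold R k)
    (M' : smoothManifold R m) (f : M -> M') (V : normedModType R)
    (O : set M) (W : chart M' -> M -> V) : Prop :=
  forall c : chart M', smooth_fun (O `&` f @^-1` chart_dom c) (W c).

(* Smooth sections over [O] of the pull-back f^*TM'; [W c p] is the row of
   components of W(p) in the chart [c] of M' around f(p). *)
Definition section_along (R : realType) k m (M : smoothManifold R k)
    (M' : smoothManifold R m) (f : M -> M') (O : set M)
    (W : chart M' -> M -> 'rV[R]_m) : Prop :=
  smooth_components f O W /\
  (forall c d p, O p -> chart_dom c (f p) -> chart_dom d (f p) ->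
     W d p = W c p *m jac c d (f p)).

Definition vector_field (R : realType) m (M : smoothManifold R m) (O : set M)
    (X : chart M -> M -> 'rV[R]_m) : Prop :=
  section_along (fun p : M => p) O X.

Definition one_form (R : realType) m (M : smoothManifold R m) (O : set M)
    (w : chart M -> M -> 'cV[R]_m) : Prop :=
  smooth_components (fun p : M => p) O w /\
  (forall c d p, O p -> chart_dom c p -> chart_dom d p ->
     w c p = jac c d p *m w d p).

Definition tensor11 (R : realType) m (M : smoothManifold R m) (O : set M)
    (F : chart M -> M -> 'M[R]_m) : Prop :=
  smooth_components (fun p : M => p) O F /\
  (forall c d p, O p -> chart_dom c p -> chart_dom d p ->
     jac c d p *m F d p = F c p *m jac c d p).

Definition tensor02 (R : realType) m (M : smoothManifold R m) (O : set M)
    (g : chart M -> M -> 'M[R]_m) : Prop :=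
  smooth_components (fun p : M => p) O g /\
  (forall c d p, O p -> chart_dom c p -> chart_dom d p ->
     g c p = jac c d p *m g d p *m (jac c d p)^T).

(* Smooth rank-[s] subbundles of f^*TM', given fibrewise by row spaces. *)
Definition subbundle_along (R : realType) k m (M : smoothManifold R k)
    (M' : smoothManifold R m) (f : M -> M') (s : nat)
    (D : chart M' -> M -> 'M[R]_m) : Prop :=
  forall p : M, exists O : set M, [/\ open O, O p &
    exists E : 'I_s -> chart M' -> M -> 'rV[R]_m,
      (forall i, section_along f O (E i)) /\
      (forall c q, O q -> chart_dom c (f q) ->
         row_free (\matrix_(i < s) E i c q) /\
         (\matrix_(i < s) E i c q :=: D c q)%MS)].

(** ** Differential operators *)

(* Lie bracket, in chart [c], of the fields with component functions X and Y. *)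
Definition lie_bracket (R : realType) m (M : smoothManifold R m) (c : chart M)
    (X Y : M -> 'rV[R]_m) (p : M) : 'rV[R]_m :=
  dir_derive c (X p) Y p - dir_derive c (Y p) X p.

(* [F,F](X,Y) = F^2[X,Y] + [FX,FY] - F[FX,Y] - F[X,FY].  This is tensorial, so
   it is evaluated on the fields with constant components x, y in [c]. *)
Definition nijenhuis (R : realType) m (M : smoothManifold R m)
    (F : chart M -> M -> 'M[R]_m) (c : chart M) (p : M) (x y : 'rV[R]_m)
    : 'rV[R]_m :=
  let X := fun _ : M => x in
  let Y := fun _ : M => y in
  let FX := fun q : M => x *m F c q in
  let FY := fun q : M => y *m F c q in
  lie_bracket c X Y p *m F c p *m F c p + lie_bracket c FX FY p
  - lie_bracket c FX Y p *m F c p - lie_bracket c X FY p *m F c p.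

(* 2 dw(X,Y) = X(w(Y)) - Y(w(X)) - w([X,Y]), on constant fields of [c].  The
   factors 1/2 here and in [wedge11] are those for which
   nabla_X U = - G X + sigma(X) V is compatible with
   du = g(., G .) + sigma /\ v. *)
Definition ext_d (R : realType) m (M : smoothManifold R m)
    (w : chart M -> M -> 'cV[R]_m) (c : chart M) (p : M) (x y : 'rV[R]_m) : R :=
  2^-1 * (dir_derive c x (fun q => covec_val (w c q) y) p
          - dir_derive c y (fun q => covec_val (w c q) x) p).

Definition wedge11 (R : fieldType) m (s t : 'rV[R]_m -> R) (x y : 'rV[R]_m) : R :=
  2^-1 * (s x * t y - s y * t x).

(* Christoffel symbols Gamma^l_ij of the Levi-Civita connection of g. *)
Definition christoffel (R : realType) m (M : smoothManifold R m)
    (g : chart M -> M -> 'M[R]_m) (c : chart M) (p : M) (l i j : 'I_m) : R :=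
  let dg (h a b : 'I_m) := dir_derive c (delta_mx 0 h) (fun q => g c q a b) p in
  2^-1 * \sum_h invmx (g c p) l h * (dg i j h + dg j i h - dg h i j).

(* Levi-Civita derivative of a section W of f^*TM' along the vector with
   components x in the chart e of M; the result is given in the chart c of M'. *)
Definition nabla (R : realType) k m (M : smoothManifold R k)
    (M' : smoothManifold R m) (g : chart M' -> M' -> 'M[R]_m) (f : M -> M')
    (e : chart M) (c : chart M') (x : 'rV[R]_k) (W : M -> 'rV[R]_m) (p : M)
    : 'rV[R]_m :=
  dir_derive e x W p +
  \row_l \sum_i \sum_j
    christoffel g c (f p) l i j * (x *m tangent_map f e c p) 0 i * W p 0 j.

(** ** Holomorphic objects *)

Definition holomorphic_atlas (R : realType) N (M : smoothManifold R (N + N))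
    : Prop :=
  forall (c d : chart M) (p : M), chart_dom c p -> chart_dom d p ->
    jac c d p *m stdJ R N = stdJ R N *m jac c d p.

Definition to_complex_mx (R : realType) m n (A : 'M[R]_(m, n))
    : 'M[complex R]_(m, n) := map_mx (real_complex R) A.

Definition dir_deriveC (R : realType) m (M : smoothManifold R m) (c : chart M)
    (x : 'rV[R]_m) (h : M -> complex R) (p : M) : complex R :=
  Complex (dir_derive c x (fun q => complex.Re (h q)) p)
          (dir_derive c x (fun q => complex.Im (h q)) p).

Definition holomorphic (R : realType) N (M : smoothManifold R (N + N))
    (O : set M) (h : M -> complex R) : Prop :=
  [/\ smooth_fun O (fun q => complex.Re (h q) : R^o),
      smooth_fun O (fun q => complex.Im (h q) : R^o) &
      forall (c : chart M) (p : M) (x : 'rV[R]_(N + N)), O p -> chart_dom c p ->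
        dir_deriveC c (x *m stdJ R N) h p = 'i * dir_deriveC c x h p].

Definition covec_valC (R : realType) m (w : 'cV[complex R]_m) (x : 'rV[R]_m)
    : complex R := (to_complex_mx x *m w) 0 0.

(* A complex-valued 1-form of type (1,0) with holomorphic components. *)
Definition holomorphic_one_form (R : realType) N (M : smoothManifold R (N + N))
    (O : set M) (th : chart M -> M -> 'cV[complex R]_(N + N)) : Prop :=
  [/\ forall c d p, O p -> chart_dom c p -> chart_dom d p ->
        th c p = to_complex_mx (jac c d p) *m th d p,
      forall c p, O p -> chart_dom c p ->
        stdJ (complex R) N *m th c p = 'i *: th c p &
      forall c i, holomorphic (O `&` chart_dom c) (fun q => th c q i 0)].

Definition ext_dC (R : realType) m (M : smoothManifold R m)
    (th : chart M -> M -> 'cV[complex R]_m) (c : chart M) (p : M)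
    (x y : 'rV[R]_m) : complex R :=
  2^-1 * (dir_deriveC c x (fun q => covec_valC (th c q) y) p
          - dir_deriveC c y (fun q => covec_valC (th c q) x) p).

(* theta /\ (d theta)^n on the vectors x_0, ..., x_2n, up to a nonzero
   constant. *)
Definition contact_volume (R : realType) m n (M : smoothManifold R m)
    (th : chart M -> M -> 'cV[complex R]_m) (c : chart M) (p : M)
    (x : 'I_(n.*2.+1) -> 'rV[R]_m) : complex R :=
  \sum_(s : 'S_(n.*2.+1)) (-1) ^+ s * covec_valC (th c p) (x (s ord0)) *
    \prod_(i < n) ext_dC th c p (x (s (inord i.*2.+1))) (x (s (inord i.*2.+2))).

(** ** Indefinite complex contact manifolds *)

(* The complex dimension 2n + 1. *)
Definition cdim (n : nat) : nat := n.*2.+1.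

(* sigma(X) = g(nabla_X U, V) *)
Definition sigma_form (R : realType) m (M : smoothManifold R m)
    (g : chart M -> M -> 'M[R]_m) (U V : chart M -> M -> 'rV[R]_m)
    (c : chart M) (p : M) (x : 'rV[R]_m) : R :=
  form_val (g c p) (nabla g (fun q : M => q) c c x (U c) p) (V c p).

(* J has the constant matrix [stdJ] in every chart of the holomorphic atlas.
   [contact_patch] indexes the open cover carrying the local forms. *)
Record complexContactManifold (R : realType) (n q : nat) :=
    ComplexContactManifold {
  ccm_man :> smoothManifold R (cdim n + cdim n);
  ccm_holomorphic : holomorphic_atlas ccm_man;

  contact_patch : Type;
  patch_dom : contact_patch -> set ccm_man;
  pdom_open : forall a, open (patch_dom a);
  pdom_cover : forall p, exists a, patch_dom a p;

  theta : contact_patch -> chart ccm_man -> ccm_man ->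
    'cV[complex R]_(cdim n + cdim n);
  theta_holomorphic : forall a, holomorphic_one_form (patch_dom a) (theta a);
  theta_contact : forall a c p, patch_dom a p -> chart_dom c p ->
    exists x, contact_volume (n := n) (theta a) c p x != 0;
  theta_overlap : forall a b, exists h : ccm_man -> complex R,
    holomorphic (patch_dom a `&` patch_dom b) h /\
    forall p, patch_dom a p -> patch_dom b p -> h p != 0 /\
      forall c, chart_dom c p -> theta a c p = h p *: theta b c p;

  met : chart ccm_man -> ccm_man -> 'M[R]_(cdim n + cdim n);
  met_tensor : tensor02 setT met;
  met_sym : forall c p, chart_dom c p -> (met c p)^T = met c p;
  met_nondeg : forall c p, chart_dom c p -> met c p \in unitmx;
  met_index : forall c p, chart_dom c p -> has_index (met c p) (4 * q)%N;
  met_hermitian : forall c p, chart_dom c p ->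
    stdJ R (cdim n) *m met c p *m (stdJ R (cdim n))^T = met c p;

  uform : contact_patch -> chart ccm_man -> ccm_man -> 'cV[R]_(cdim n + cdim n);
  vform : contact_patch -> chart ccm_man -> ccm_man -> 'cV[R]_(cdim n + cdim n);
  Ufield : contact_patch -> chart ccm_man -> ccm_man -> 'rV[R]_(cdim n + cdim n);
  Vfield : contact_patch -> chart ccm_man -> ccm_man -> 'rV[R]_(cdim n + cdim n);
  Gten : contact_patch -> chart ccm_man -> ccm_man -> 'M[R]_(cdim n + cdim n);
  Hten : contact_patch -> chart ccm_man -> ccm_man -> 'M[R]_(cdim n + cdim n);
  uform_form : forall a, one_form (patch_dom a) (uform a);
  vform_form : forall a, one_form (patch_dom a) (vform a);
  Ufield_field : forall a, vector_field (patch_dom a) (Ufield a);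
  Vfield_field : forall a, vector_field (patch_dom a) (Vfield a);
  Gten_tensor : forall a, tensor11 (patch_dom a) (Gten a);
  Hten_tensor : forall a, tensor11 (patch_dom a) (Hten a);

  (* theta = lambda (u - i v) *)
  theta_uv : forall a, exists lam : ccm_man -> complex R,
    forall p, patch_dom a p -> lam p != 0 /\
      forall c, chart_dom c p -> theta a c p =
        lam p *: (to_complex_mx (uform a c p) - 'i *: to_complex_mx (vform a c p));

  (* v = u o J,  V = - J U,  g(U,.) = u,  u(U) = 1,  g(U,V) = 0 *)
  vform_def : forall a c p, patch_dom a p -> chart_dom c p ->
    vform a c p = stdJ R (cdim n) *m uform a c p;
  Vfield_def : forall a c p, patch_dom a p -> chart_dom c p ->
    Vfield a c p = - (Ufield a c p *m stdJ R (cdim n));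
  Ufield_dual : forall a c p, patch_dom a p -> chart_dom c p ->
    forall x, form_val (met c p) (Ufield a c p) x = covec_val (uform a c p) x;
  uform_Ufield : forall a c p, patch_dom a p -> chart_dom c p ->
    covec_val (uform a c p) (Ufield a c p) = 1;
  UV_orth : forall a c p, patch_dom a p -> chart_dom c p ->
    form_val (met c p) (Ufield a c p) (Vfield a c p) = 0;

  (* H = GJ = - JG,  GU = 0,  G^2 = H^2 = - I + u (x) U + v (x) V *)
  Hten_def : forall a c p, patch_dom a p -> chart_dom c p ->
    Hten a c p = stdJ R (cdim n) *m Gten a c p;
  GJ_anticomm : forall a c p, patch_dom a p -> chart_dom c p ->
    stdJ R (cdim n) *m Gten a c p = - (Gten a c p *m stdJ R (cdim n));
  Gten_U : forall a c p, patch_dom a p -> chart_dom c p ->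
    Ufield a c p *m Gten a c p = 0;
  Gten_sqr : forall a c p, patch_dom a p -> chart_dom c p ->
    Gten a c p *m Gten a c p =
      - 1%:M + uform a c p *m Ufield a c p + vform a c p *m Vfield a c p;
  Hten_sqr : forall a c p, patch_dom a p -> chart_dom c p ->
    Hten a c p *m Hten a c p =
      - 1%:M + uform a c p *m Ufield a c p + vform a c p *m Vfield a c p;
  Gten_skew : forall a c p, patch_dom a p -> chart_dom c p ->
    forall x y, form_val (met c p) (x *m Gten a c p) y =
                - form_val (met c p) x (y *m Gten a c p);

  uvGH_overlap : forall a b p, patch_dom a p -> patch_dom b p ->
    exists s t : R, s ^+ 2 + t ^+ 2 = 1 /\
      forall c, chart_dom c p ->
        [/\ uform b c p = s *: uform a c p - t *: vform a c p,
            vform b c p = t *: uform a c p + s *: vform a c p,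
            Gten b c p = s *: Gten a c p - t *: Hten a c p &
            Hten b c p = t *: Gten a c p + s *: Hten a c p];

  (* du = g(.,G.) + sigma /\ v,  dv = g(.,H.) - sigma /\ u *)
  d_uform : forall a c p, patch_dom a p -> chart_dom c p -> forall x y,
    ext_d (uform a) c p x y =
      form_val (met c p) x (y *m Gten a c p)
      + wedge11 (sigma_form met (Ufield a) (Vfield a) c p)
                (covec_val (vform a c p)) x y;
  d_vform : forall a c p, patch_dom a p -> chart_dom c p -> forall x y,
    ext_d (vform a) c p x y =
      form_val (met c p) x (y *m Hten a c p)
      - wedge11 (sigma_form met (Ufield a) (Vfield a) c p)
                (covec_val (uform a c p)) x y
}.
Arguments contact_patch {R n q} Mb : rename.
Arguments patch_dom {R n q Mb} : rename.
Arguments met {R n q Mb} : rename.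
Arguments uform {R n q Mb} : rename.
Arguments vform {R n q Mb} : rename.
Arguments Ufield {R n q Mb} : rename.
Arguments Vfield {R n q Mb} : rename.
Arguments Gten {R n q Mb} : rename.
Arguments Hten {R n q Mb} : rename.

Definition sigma (R : realType) n q (Mb : complexContactManifold R n q)
    (a : contact_patch Mb) : chart Mb -> Mb -> 'rV[R]_(cdim n + cdim n) -> R :=
  sigma_form met (Ufield a) (Vfield a).

Definition tensorS (R : realType) n q (Mb : complexContactManifold R n q)
    (a : contact_patch Mb) (c : chart Mb) (p : Mb) (x y : 'rV[R]_(cdim n + cdim n))
    : 'rV[R]_(cdim n + cdim n) :=
  let G := Gten a c p in let H := Hten a c p in
  let v := covec_val (vform a c p) in
  let sg := sigma a c p in let g := form_val (met c p) in
  nijenhuis (Gten a) c p x y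
  + (2 * g x (y *m G)) *: Ufield a c p - (2 * g x (y *m H)) *: Vfield a c p
  + 2 *: (v y *: (x *m H) - v x *: (y *m H))
  + sg (y *m G) *: (x *m H) - sg (x *m G) *: (y *m H)
  + sg x *: (y *m H *m G) - sg y *: (x *m H *m G).

Definition tensorT (R : realType) n q (Mb : complexContactManifold R n q)
    (a : contact_patch Mb) (c : chart Mb) (p : Mb) (x y : 'rV[R]_(cdim n + cdim n))
    : 'rV[R]_(cdim n + cdim n) :=
  let G := Gten a c p in let H := Hten a c p in
  let u := covec_val (uform a c p) in
  let sg := sigma a c p in let g := form_val (met c p) in
  nijenhuis (Hten a) c p x y
  - (2 * g x (y *m G)) *: Ufield a c p + (2 * g x (y *m H)) *: Vfield a c p
  + 2 *: (u y *: (x *m G) - u x *: (y *m G))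
  + sg (x *m H) *: (y *m G) - sg (y *m H) *: (x *m G)
  + sg x *: (y *m H *m G) - sg y *: (x *m H *m G).

Definition horizontal (R : realType) n q (Mb : complexContactManifold R n q)
    (a : contact_patch Mb) (c : chart Mb) (p : Mb)
    (x : 'rV[R]_(cdim n + cdim n)) : Prop :=
  (x <= orth (met c p) (Ufield a c p + Vfield a c p)%MS)%MS.

Definition normal_contact (R : realType) n q (Mb : complexContactManifold R n q)
    : Prop :=
  forall (a : contact_patch Mb) (c : chart Mb) (p : Mb),
    patch_dom a p -> chart_dom c p ->
    (forall x y, horizontal a c p x -> horizontal a c p y ->
       tensorS a c p x y = 0 /\ tensorT a c p x y = 0) /\
    (forall x, tensorS a c p (Ufield a c p) x = 0 /\
               tensorT a c p (Vfield a c p) x = 0).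

(* (J_1, J_2, J_3) = (J, G, H), indexed by 'I_3 = {0, 1, 2}. *)
Definition Jten (R : realType) n q (Mb : complexContactManifold R n q)
    (a : 'I_3) (i : contact_patch Mb) (c : chart Mb) (p : Mb)
    : 'M[R]_(cdim n + cdim n) :=
  tnth [tuple stdJ R (cdim n); Gten i c p; Hten i c p] a.

(** ** Null submanifolds *)

(* An injectively immersed k-dimensional submanifold.  All the bundles over it
   are subbundles of sub_incl^*(T Mb), given in the charts of the ambient manifold;
   [tangent_map sub_incl e c p] has the tangent space of the submanifold as its row
   space. *)
Record nullSubmanifold (R : realType) (n q : nat)
    (Mb : complexContactManifold R n q) (k r : nat) := NullSubmanifold {
  sub_man :> smoothManifold R k;
  sub_incl : sub_man -> Mb;
  sub_incl_smooth : smooth_map sub_incl;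
  sub_incl_inj : injective sub_incl;
  sub_incl_immersion : forall e c p, chart_dom e p -> chart_dom c (sub_incl p) ->
    row_free (tangent_map sub_incl e c p);

  RadTM : chart Mb -> sub_man -> 'M[R]_(cdim n + cdim n);
  r_gt0 : (0 < r)%N;
  RadTM_bundle : subbundle_along sub_incl r RadTM;
  RadTM_def : forall e c p, chart_dom e p -> chart_dom c (sub_incl p) ->
    let TM := tangent_map sub_incl e c p in
    (RadTM c p :=: TM :&: orth (met c (sub_incl p)) TM)%MS;

  STM : chart Mb -> sub_man -> 'M[R]_(cdim n + cdim n);
  STM_bundle : exists s, subbundle_along sub_incl s STM;
  STM_screen : forall e c p, chart_dom e p -> chart_dom c (sub_incl p) ->
    let g := met c (sub_incl p) in
    let TM := tangent_map sub_incl e c p in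
    [/\ nondegenerate_on g (STM c p),
        (TM :=: RadTM c p + STM c p)%MS,
        mxdirect (RadTM c p + STM c p) &
        orthogonal_spaces g (RadTM c p) (STM c p)];

  STMperp : chart Mb -> sub_man -> 'M[R]_(cdim n + cdim n);
  STMperp_bundle : exists s, subbundle_along sub_incl s STMperp;
  STMperp_screen : forall e c p, chart_dom e p -> chart_dom c (sub_incl p) ->
    let g := met c (sub_incl p) in
    let TM := tangent_map sub_incl e c p in
    [/\ nondegenerate_on g (STMperp c p),
        (orth g TM :=: RadTM c p + STMperp c p)%MS,
        mxdirect (RadTM c p + STMperp c p) &
        orthogonal_spaces g (RadTM c p) (STMperp c p)];

  ltrTM : chart Mb -> sub_man -> 'M[R]_(cdim n + cdim n);
  ltrTM_def : forall p, exists O : set sub_man, [/\ open O, O p &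
    exists xi N : 'I_r -> chart Mb -> sub_man -> 'rV[R]_(cdim n + cdim n),
      (forall i, section_along sub_incl O (xi i) /\
                 section_along sub_incl O (N i)) /\
      forall c p', O p' -> chart_dom c (sub_incl p') ->
        let g := met c (sub_incl p') in
        [/\ (\matrix_(i < r) xi i c p' :=: RadTM c p')%MS,
            (\matrix_(i < r) N i c p' :=: ltrTM c p')%MS,
            forall i, (N i c p' <=
              orth g (STM c p') :&: orth g (STMperp c p'))%MS,
            forall i j, form_val g (xi i c p') (N j c p') = (i == j)%:R &
            forall i j, form_val g (N i c p') (N j c p') = 0]]
}.
Arguments sub_incl {R n q Mb k r} M : rename.
Arguments RadTM {R n q Mb k r M} : rename.
Arguments STM {R n q Mb k r M} : rename.
Arguments STMperp {R n q Mb k r M} : rename.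
Arguments ltrTM {R n q Mb k r M} : rename.

Definition screen_transversal_anti_invariant (R : realType) n q
    (Mb : complexContactManifold R n q) k r (M : nullSubmanifold Mb k r) : Prop :=
  forall (i : contact_patch Mb) (c : chart Mb) (p : M),
    patch_dom i (sub_incl M p) -> chart_dom c (sub_incl M p) ->
    [/\ (Ufield i c (sub_incl M p) + Vfield i c (sub_incl M p) <= STMperp c p)%MS,
        forall a : 'I_3, (RadTM c p *m Jten a i c (sub_incl M p) <= STMperp c p)%MS,
        forall a : 'I_3, (STM c p *m Jten a i c (sub_incl M p) <= STMperp c p)%MS &
        forall a : 'I_3,
          (ltrTM c p *m Jten a i c (sub_incl M p) <= STMperp c p)%MS].

(* S(TM^perp) = {J_a Rad TM (+) J_a ltr(TM)} perp J_a S(TM) perp D_0, with D_0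
   nondegenerate and J_a-invariant.  Since G and H are only defined on the
   patches, so is D_0; it also depends on a. *)
Definition transversal_decomposition (R : realType) n q
    (Mb : complexContactManifold R n q) k r (M : nullSubmanifold Mb k r)
    (a : 'I_3)
    (D0 : contact_patch Mb -> chart Mb -> M -> 'M[R]_(cdim n + cdim n)) : Prop :=
  forall (i : contact_patch Mb) (c : chart Mb) (p : M),
    patch_dom i (sub_incl M p) -> chart_dom c (sub_incl M p) ->
    let g := met c (sub_incl M p) in
    let Ja := Jten a i c (sub_incl M p) in
    let JRad := RadTM c p *m Ja in
    let Jltr := ltrTM c p *m Ja in
    let JS := STM c p *m Ja in
    let D := D0 i c p in
    [/\ (STMperp c p :=: JRad + Jltr + JS + D)%MS,
        mxdirect (JRad + Jltr + JS + D),
        orthogonal_spaces g (JRad + Jltr)%MS JS /\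
          orthogonal_spaces g (JRad + Jltr + JS)%MS D,
        nondegenerate_on g D &
        (D *m Ja <= D)%MS].

(* Components in sub_incl^*(T Mb) of the vector field X of M. *)
Definition push (R : realType) n q (Mb : complexContactManifold R n q) k r
    (M : nullSubmanifold Mb k r) (X : chart M -> M -> 'rV[R]_k)
    (e : chart M) (c : chart Mb) (p : M) : 'rV[R]_(cdim n + cdim n) :=
  X e p *m tangent_map (sub_incl M) e c p.

Definition screen_section (R : realType) n q
    (Mb : complexContactManifold R n q) k r (M : nullSubmanifold Mb k r)
    (X : chart M -> M -> 'rV[R]_k) : Prop :=
  vector_field setT X /\
  forall e c p, chart_dom e p -> chart_dom c (sub_incl M p) ->
    (push X e c p <= STM c p)%MS.

(* J_a Z along M, for a vector field Z of M. *)
Definition Jpush (R : realType) n q (Mb : complexContactManifold R n q) k r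
    (M : nullSubmanifold Mb k r) (a : 'I_3) (i : contact_patch Mb)
    (Z : chart M -> M -> 'rV[R]_k) (e : chart M) (c : chart Mb) (p : M)
    : 'rV[R]_(cdim n + cdim n) :=
  push Z e c p *m Jten a i c (sub_incl M p).

(* Integrability of a distribution in the sense of Spivak: [X,Y] belongs to it
   whenever X and Y do. *)
Definition screen_integrable (R : realType) n q
    (Mb : complexContactManifold R n q) k r (M : nullSubmanifold Mb k r) : Prop :=
  forall X Y : chart M -> M -> 'rV[R]_k,
    screen_section X -> screen_section Y ->
    forall e c p, chart_dom e p -> chart_dom c (sub_incl M p) ->
      (lie_bracket e (X e) (Y e) p *m tangent_map (sub_incl M) e c p <= STM c p)%MS.

(* nabla^s_X W: the S(TM^perp)-component of the ambient derivative in
   S(TM^perp) (+) (TM (+) ltr(TM)). *)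
Definition nabla_s (R : realType) n q (Mb : complexContactManifold R n q) k r
    (M : nullSubmanifold Mb k r) (e : chart M) (c : chart Mb) (x : 'rV[R]_k)
    (W : M -> 'rV[R]_(cdim n + cdim n)) (p : M) : 'rV[R]_(cdim n + cdim n) :=
  nabla met (sub_incl M) e c x W p
  *m proj_mx (STMperp c p) (tangent_map (sub_incl M) e c p + ltrTM c p)%MS.

(* The J_a Rad TM-component, with respect to [transversal_decomposition]. *)
Definition JRad_component (R : realType) n q
    (Mb : complexContactManifold R n q) k r (M : nullSubmanifold Mb k r)
    (a : 'I_3)
    (D0 : contact_patch Mb -> chart Mb -> M -> 'M[R]_(cdim n + cdim n))
    (i : contact_patch Mb) (c : chart Mb) (p : M) (w : 'rV[R]_(cdim n + cdim n))
    : 'rV[R]_(cdim n + cdim n) :=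
  let Ja := Jten a i c (sub_incl M p) in
  w *m proj_mx (RadTM c p *m Ja)
         (ltrTM c p *m Ja + STM c p *m Ja + D0 i c p)%MS.

(* Main.v *)
Require Import Defs.
From mathcomp Require Import all_boot all_order all_algebra.
From mathcomp Require Import all_classical all_reals all_analysis.
From mathcomp Require Import ring lra.

Set Implicit Arguments.
Unset Strict Implicit.
Unset Printing Implicit Defensive.

Import Order.TTheory GRing.Theory Num.Theory.
Import numFieldNormedType.Exports.

Local Open Scope classical_set_scope.
Local Open Scope ring_scope.

(** The equivalence holds point by point, for each pair X, Y of sections of the
    screen. Put F = J_a, and let N run over ltr(TM).

    The bracket [X,Y] is tangent to M, and TM = Rad TM + S(TM), where S(TM) is
    orthogonal to ltr(TM) and Rad TM is dual to it. Hence [X,Y] lies in the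
    screen exactly when all the numbers g([X,Y], N) vanish ([TM_sub_S]). The
    vectors tangent to M and the null transversal ones are horizontal, and F is
    an isometry on horizontal vectors. So the vectors F N are dual to F Rad TM
    and orthogonal to the other summands of S(TM^perp), and a vector w of
    S(TM^perp) has no F Rad TM component exactly when all the numbers g(w, F N)
    vanish ([RadF_component_eq0]). As F N is in S(TM^perp), replacing nabla^s by
    the ambient connection does not change these numbers ([proj_Sp_form]). What
    has to be shown is therefore
      g(nabla_X (F Y) - nabla_Y (F X), F N) = g([X,Y], N)      ([bracket_ltr]).
    The connection is torsion free, so the difference of the two sides is
    g((nabla_X F) Y - (nabla_Y F) X, F N), and each of its terms is zero by the
    following formulas on a normal manifold, for horizontal x, y, z:
      g((nabla_z G) x, y) =   sigma(z) g(H x, y)     ([nabla_Gten_horizontal]),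
      g((nabla_z H) x, y) = - sigma(z) g(G x, y)     ([nabla_Hten_horizontal]),
      g((nabla_z J) x, y) = 0                        ([nabla_stdJ_horizontal]).
    Indeed, with x in S(TM) and y = F N these values are, up to sign, multiples
    of g(J x, N), and J S(TM) is contained in S(TM^perp), to which N is
    orthogonal.

    The first two formulas have a common proof. Put
      A(z,x,y) = g((nabla_z F) x, y)
    and let om(z,x,y) be its cyclic sum. As in almost Hermitian geometry
    ([nabla_endo_formula]),
      2 A(z,x,y) = g([F,F](x,y), F z) - om(z, F x, F y) + om(z,x,y).
    Normality gives the Nijenhuis tensor [F,F]. The cyclic sum is, up to sign,
    the exterior derivative of Phi = g(., F .); for F = G the structure equation
    du = Phi + sigma /\ v and d(du) = 0 leave only sigma /\ dv on horizontal
    vectors ([cyclic_derivative]), and for H the argument is the same with dv.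
    The formula for J follows from H = G J by the product rule. *)

(** * Calculus of matrix-valued functions *)

Section MatrixCalculus.
Context {R : realType} {V : normedModType R}.
Implicit Types x v : V.

Lemma is_derive_mxP m n (A : V -> 'M[R]_(m, n)) (dA : 'M[R]_(m, n)) x v :
  is_derive x v A dA <->
  forall i j, is_derive x v (fun y => A y i j) (dA i j).
Proof.
split=> [[Ax <-] i j|dAx].
  have Aij : derivable (fun y => A y i j) x v by move/derivable_mxP: Ax; apply.
  by apply: DeriveDef => //; rewrite derive_mx// mxE.
have Ax : derivable A x v.
  by apply/derivable_mxP => i j; apply: (@ex_derive _ _ _ _ _ _ _ (dAx i j)).
apply: DeriveDef => //; rewrite derive_mx//; apply/matrixP => i j.
by rewrite mxE; apply: (@derive_val _ _ _ _ _ _ _ (dAx i j)).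
Qed.

Lemma is_derive_mulmx m n p (A : V -> 'M[R]_(m, n)) (B : V -> 'M[R]_(n, p))
    dA dB x v :
  is_derive x v A dA -> is_derive x v B dB ->
  is_derive x v (fun y => A y *m B y) (dA *m B x + A x *m dB).
Proof.
move=> /is_derive_mxP dAx /is_derive_mxP dBx; apply/is_derive_mxP => i j.
have -> : (fun y => (A y *m B y) i j) =
    \sum_(k < n) ((fun y => A y i k) * (fun y => B y k j)).
  by apply/funext => y; rewrite mxE fct_sumE.
have h k := is_deriveM (dAx i k) (dBx k j).
have H := is_derive_sum h. refine (is_derive_eq H _).
rewrite !mxE -big_split /=; apply: eq_bigr => k _.
by rewrite addrC; congr (_ + _); exact: mulrC.
Qed.

Lemma is_derive_trmx m n (A : V -> 'M[R]_(m, n)) dA x v :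
  is_derive x v A dA -> is_derive x v (fun y => (A y)^T) dA^T.
Proof.
move=> /is_derive_mxP dAx; apply/is_derive_mxP => i j; rewrite mxE.
by under [X in is_derive _ _ X _]funext do rewrite mxE.
Qed.

Lemma is_derive_form m (g : V -> 'M[R]_m) (X Y : V -> 'rV[R]_m) dg dX dY x v :
  is_derive x v g dg -> is_derive x v X dX -> is_derive x v Y dY ->
  is_derive x v (fun y => form_val (g y) (X y) (Y y))
    (form_val dg (X x) (Y x) + form_val (g x) dX (Y x)
      + form_val (g x) (X x) dY).
Proof.
move=> hg hX hY.
have /is_derive_mxP/(_ 0 0) := is_derive_mulmx (is_derive_mulmx hX hg)
  (is_derive_trmx hY).
move/is_derive_eq; apply; rewrite /form_val mulmxDl !mxE.
by rewrite [X in X + _ = _]addrC.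
Qed.

End MatrixCalculus.

(** * Symmetry of second derivatives *)

Section Schwarz.
Context {R : realType} {V : normedModType R}.
Implicit Types (x u v : V) (h : V -> R).

Lemma is_derive_line h x u (s : R) : derivable h (x + s *: u) u ->
  is_derive s 1 (fun s => h (x + s *: u)) ('D_u h (x + s *: u)).
Proof.
have E : (fun k => k^-1 *: (((fun s => h (x + s *: u)) \o shift s) (k *: 1)
                     - h (x + s *: u))) =
         (fun k => k^-1 *: ((h \o shift (x + s *: u)) (k *: u)
           - h (x + s *: u))).
  apply/funext => k /=; congr (_ *: (h _ - _)).
  by rewrite [k *: 1]mulr1 scalerDl addrCA.
by move=> hx; split; rewrite /derivable /derive E.
Qed.

(** The mean value theorem in the direction u for the increment of h along t v,
    and then in the direction v for the derivative of h along u. *)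
Lemma second_difference_MVT h x u v (t : R) : 0 < t ->
  (forall s s', 0 <= s <= t -> 0 <= s' <= t ->
     derivable h (x + s *: u + s' *: v) u /\
     derivable ('D_u h) (x + s *: u + s' *: v) v) ->
  exists s s', [/\ 0 <= s <= t, 0 <= s' <= t &
    h (x + t *: u + t *: v) - h (x + t *: u) - (h (x + t *: v) - h x) =
    'D_v ('D_u h) (x + s *: u + s' *: v) * t * t].
Proof.
move=> t0 dh; have t0' := ltW t0.
have d0 s : 0 <= s <= t -> derivable h (x + s *: u) u.
  by move=> st; have [+ _] := dh s 0 st ltac:(by rewrite lexx);
    rewrite scale0r addr0.
pose phi s := h (x + t *: v + s *: u) - h (x + s *: u).
have dphi s : 0 <= s <= t -> is_derive s 1 phi
    ('D_u h (x + t *: v + s *: u) - 'D_u h (x + s *: u)).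
  move=> st; apply: is_deriveB; apply: is_derive_line; last exact: d0.
  have [+ _] := dh s t st ltac:(by rewrite t0' lexx).
  by rewrite addrAC.
have sub (s : R) : s \in `]0, t[%R -> 0 <= s <= t.
  by rewrite in_itv/= => /andP[/ltW -> /ltW ->].
have sub' (s : R) : s \in `[0, t]%R -> 0 <= s <= t.
  by rewrite in_itv/=.
have [|s /sub st] := @MVT _ phi _ 0 t t0 (fun s st => dphi s (sub s st)).
  by apply: derivable_within_continuous => s /sub' /dphi[].
pose psi s' := 'D_u h (x + s *: u + s' *: v).
have dpsi s' : 0 <= s' <= t ->
    is_derive s' 1 psi ('D_v ('D_u h) (x + s *: u + s' *: v)).
  by move=> s't; apply: is_derive_line; have [] := dh s s' st s't.
have [|s' /sub s't] := @MVT _ psi _ 0 t t0 (fun s' st => dpsi s' (sub s' st)).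
  by apply: derivable_within_continuous => s' /sub' /dpsi[].
rewrite /psi /phi !scale0r !addr0 subr0 => E1.
rewrite [x + t *: v + s *: u]addrAC E1 => E2; exists s, s'; split => //.
by rewrite -E2 [x + t *: v + _]addrAC; ring.
Qed.

(** The second difference of h over a small parallelogram is symmetric in u and
    v; divided by t^2, it is a value of each mixed derivative near x, and both
    are continuous at x. *)
Lemma derive_swap h x u v :
  (\forall y \near x, derivable h y u /\ derivable ('D_u h) y v) ->
  (\forall y \near x, derivable h y v /\ derivable ('D_v h) y u) ->
  {for x, continuous ('D_v ('D_u h))} -> {for x, continuous ('D_u ('D_v h))} ->
  'D_v ('D_u h) x = 'D_u ('D_v h) x.
Proof.
move=> huv hvu cvu cuv; apply/eqP; rewrite -subr_eq0 -normr_le0.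
apply/ler_addgt0Pl => _ /posnumP[e]; rewrite addr0.
have e2 : 0 < e%:num / 2 :> R by [].
have close_both (a b c : R) :
    `|a - c| < e%:num / 2 -> `|b - c| < e%:num / 2 -> `|a - b| <= e%:num.
  move=> ac bc; have -> : a - b = (a - c) - (b - c) by ring.
  by rewrite (le_trans (ler_normB _ _))// (splitr e%:num) lerD// ltW.
have rearrange (c1 c2 c3 c4 : R) : c1 - c2 - (c3 - c4) = c1 - c3 - (c2 - c4).
  by ring.
have near_all : \forall y \near x,
    [/\ derivable h y u /\ derivable ('D_u h) y v,
        derivable h y v /\ derivable ('D_v h) y u,
        `|'D_v ('D_u h) x - 'D_v ('D_u h) y| < e%:num / 2 &
        `|'D_u ('D_v h) x - 'D_u ('D_v h) y| < e%:num / 2].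
  move/cvgrPdist_lt : cvu => /(_ _ e2) cvu.
  move/cvgrPdist_lt : cuv => /(_ _ e2) cuv.
  apply: filterS (filterI (filterI huv hvu) (filterI cvu cuv)).
  by move=> y [[h1 h2] [h3 h4]]; exact: And4 h1 h2 h3 h4.
have [d /= d0 xd] := (@nbhs_ballP _ _ _ _).1 near_all.
(* The parallelogram of side t must stay in the ball of radius d; the summand 1
   covers the case u = v = 0. *)
pose t := d / 2 / (`|u| + `|v| + 1).
have n0 : 0 < `|u| + `|v| + 1 by rewrite ltr_pwDr// addr_ge0.
have t0 : 0 < t by rewrite !divr_gt0.
have small s s' : 0 <= s <= t -> 0 <= s' <= t ->
    ball x d (x + s *: u + s' *: v).
  move=> /andP[s0 st] /andP[s'0 s't]; rewrite -ball_normE /= -addrA opprD addrA.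
  rewrite subrr sub0r normrN (le_lt_trans (ler_normD _ _))// !normrZ
    !ger0_norm//.
  have : s * `|u| + s' * `|v| <= t * (`|u| + `|v| + 1).
    have := ler_wpM2r (normr_ge0 u) st; have := ler_wpM2r (normr_ge0 v) s't.
    by move: t0; nra.
  move=> /le_lt_trans; apply; rewrite /t divfK ?gt_eqF//.
  by move: d0; lra.
have [s [s' [st s't E1]]] := second_difference_MVT t0
  (fun a a' at_ a't => let: And4 H _ _ _ := xd _ (small a a' at_ a't) in H).
have small' a a' : 0 <= a <= t -> 0 <= a' <= t ->
    ball x d (x + a *: v + a' *: u).
  by move=> at_ a't; rewrite addrAC; exact: small.
have [p [p' [pt p't E2]]] := second_difference_MVT t0
  (fun a a' at_ a't => let: And4 _ H _ _ := xd _ (small' a a' at_ a't) in H).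
have {}E1 : 'D_v ('D_u h) (x + s *: u + s' *: v) =
            'D_u ('D_v h) (x + p *: v + p' *: u).
  apply: (mulIf (lt0r_neq0 t0)); apply: (mulIf (lt0r_neq0 t0)).
  rewrite [x + t *: v + t *: u]addrAC in E2.
  exact: etrans (esym E1) (etrans (rearrange _ _ _ _) E2).
have [_ _ H1 _] := xd _ (small _ _ st s't).
have [_ _ _ H2] := xd _ (small' _ _ pt p't).
move: H2; rewrite -E1 => H2.
exact: close_both H1 H2.
Qed.

End Schwarz.

Section SmoothOn.
Context {R : realType} {k : nat}.
Implicit Types (D : set 'rV[R]_k) (x v u : 'rV[R]_k).

Lemma smooth_on_differentiable {W : normedModType R} D (f : 'rV[R]_k -> W) x :
  smooth_on D f -> D x -> differentiable f x.
Proof. by move=> sf Dx; exact: (sf [::]). Qed.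

Lemma smooth_on_derive {W : normedModType R} D (f : 'rV[R]_k -> W) v :
  smooth_on D f -> smooth_on D ('D_v f).
Proof. by move=> sf vs; exact: (sf (v :: vs)). Qed.

Lemma smooth_on_is_derive {W : normedModType R} D (f : 'rV[R]_k -> W) x v :
  smooth_on D f -> D x -> is_derive x v f ('D_v f x).
Proof.
by move=> sf Dx; apply/derivableP/diff_derivable;
  apply: smooth_on_differentiable Dx.
Qed.

Lemma derive_entry_on m n D (f : 'rV[R]_k -> 'M[R]_(m, n)) i j x v :
  smooth_on D f -> D x -> 'D_v (fun y => f y i j) x = 'D_v f x i j.
Proof.
move=> sf Dx; have /is_derive_mxP/(_ i j)[] := smooth_on_is_derive v sf Dx.
by [].
Qed.

Lemma derivable_entry_on m n D (f : 'rV[R]_k -> 'M[R]_(m, n)) i j x v :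
  smooth_on D f -> D x -> derivable (fun y => f y i j) x v.
Proof.
move=> sf Dx; have /is_derive_mxP/(_ i j)[] := smooth_on_is_derive v sf Dx.
by [].
Qed.

Lemma smooth_on_derive_swap m n D (f : 'rV[R]_k -> 'M[R]_(m, n)) x u v :
  open D -> D x -> smooth_on D f -> 'D_v ('D_u f) x = 'D_u ('D_v f) x.
Proof.
move=> oD Dx sf; apply/matrixP => i j.
have Dnear y : D y -> \near y, D y by move=> Dy; exact: open_nbhs_nbhs.
pose h y := f y i j.
have D1 w y : D y -> 'D_w h y = 'D_w f y i j.
  by move=> Dy; exact: derive_entry_on sf Dy.
have d2 w w' y : D y ->
    is_derive y w' ('D_w h) ('D_w' ('D_w f) y i j).
  move=> Dy; apply: (near_eq_is_derive (f := fun y => 'D_w f y i j)).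
    by apply: filterS (Dnear y Dy) => z Dz; rewrite D1.
  by have /is_derive_mxP := smooth_on_is_derive w' (smooth_on_derive w sf) Dy.
have c2 w w' : {for x, continuous ('D_w' ('D_w h))}.
  have E : \forall y \near x, 'D_w' ('D_w f) y i j = 'D_w' ('D_w h) y.
    by apply: filterS (Dnear x Dx) => z Dz;
      rewrite (derive_val (is_derive := d2 w w' z Dz)).
  have := differentiable_continuous (differentiable_comp
    (smooth_on_differentiable (smooth_on_derive w' (smooth_on_derive w sf)) Dx)
    (differentiable_coord _ i j)).
  rewrite /prop_for/continuous_at /= (nbhs_singleton E) => c.
  exact: cvg_trans (near_eq_cvg E) c.
have d12 w w' : \forall y \near x, derivable h y w /\ derivable ('D_w h) y w'.
  apply: filterS (Dnear x Dx) => y Dy; split.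
    exact: derivable_entry_on sf Dy.
  by have [] := d2 w w' y Dy.
have := derive_swap (d12 u v) (d12 v u) (c2 u v) (c2 v u).
by rewrite (derive_val (is_derive := d2 u v x Dx))
  (derive_val (is_derive := d2 v u x Dx)).
Qed.
End SmoothOn.

(** * Charts, pull-backs and Lie brackets *)

Section Charts.
Context {R : realType}.

Lemma chart_invK m (M : smoothManifold R m) (c : chart M) (O : set M) y :
  (chart_coord c @` (O `&` chart_dom c)) y ->
  [/\ O (chart_inv c y), chart_dom c (chart_inv c y) &
      chart_coord c (chart_inv c y) = y].
Proof. by move=> [p [Op cp] <-]; rewrite coordK. Qed.

Lemma chart_image_open m (M : smoothManifold R m) (c : chart M) (O : set M) :
  open O -> open (chart_coord c @` (O `&` chart_dom c)).
Proof.
move=> oO; rewrite openE => _ [p [Op cp] <-]; rewrite /interior.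
have ran : \forall y \near chart_coord c p, (chart_coord c @` chart_dom c) y.
  by apply: open_nbhs_nbhs; split; [exact: range_open | exists p].
have invO : \forall y \near chart_coord c p, O (chart_inv c y).
  apply: (point_continuous cp); apply: open_nbhs_nbhs.
  by rewrite coordK.
apply: filterS2 ran invO => _ [q cq <-]; rewrite coordK// => Oq.
by exists q.
Qed.

Section Pullback.
Context {k m : nat} {M : smoothManifold R k} {M' : smoothManifold R m}.
Variables (f : M -> M') (e : chart M) (c : chart M').
Hypothesis sf : smooth_map f.

Let phi := chart_coord c \o f \o chart_inv e.
Let D := chart_coord e @` (f @^-1` chart_dom c `&` chart_dom e).

Let oD : open D.
Proof.
apply: chart_image_open; apply: open_comp; last exact: dom_open.
by move=> p _; apply: sf.1.
Qed.

Let sphi : smooth_on D phi.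
Proof. exact: sf.2. Qed.

(** The chain rule for F o f, written near p as the composite of F in the chart
    c with the local representative phi of f. *)
Lemma is_derive_pullback (W : normedModType R) (F : M' -> W) p x :
  chart_dom e p -> chart_dom c (f p) ->
  differentiable (F \o chart_inv c) (chart_coord c (f p)) ->
  is_derive (chart_coord e p) x ((F \o f) \o chart_inv e)
    (dir_derive c (x *m tangent_map f e c p) F (f p)).
Proof.
move=> ep cp dF.
have Dp : D (chart_coord e p) by exists p.
have dphi := smooth_on_differentiable sphi Dp.
have phip : phi (chart_coord e p) = chart_coord c (f p).
  by rewrite /phi /= coordK.
have dF' : differentiable (F \o chart_inv c) (phi (chart_coord e p)).
  by rewrite phip.
apply: (near_eq_is_derive (f := (F \o chart_inv c) \o phi)).
  apply: filterS (open_nbhs_nbhs (conj oD Dp)) => y /chart_invK[fy _ _].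
  by rewrite /phi /= coordK.
apply: DeriveDef.
  exact/diff_derivable/differentiable_comp.
rewrite deriveE; last exact: differentiable_comp.
rewrite diff_comp// /= phip /dir_derive deriveE//.
by congr ('d _ _ _); rewrite /tangent_map -deriveEjacobian// deriveE.
Qed.

(** The product rule for Y times the Jacobian of phi. The derivative of the
    Jacobian, applied to the vector Y p, is a second derivative of phi. *)
Lemma is_derive_push (Y : M -> 'rV[R]_k) p x :
  chart_dom e p -> chart_dom c (f p) ->
  derivable (Y \o chart_inv e) (chart_coord e p) x ->
  is_derive (chart_coord e p) x
    ((fun q => Y q *m tangent_map f e c q) \o chart_inv e)
    (dir_derive e x Y p *m tangent_map f e c p
     + 'D_x ('D_(Y p) phi) (chart_coord e p)).
Proof.
move=> ep cp dY.
have Dp : D (chart_coord e p) by exists p.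
have nD := open_nbhs_nbhs (conj oD Dp).
pose T y : 'M[R]_(k, m) := \matrix_(i, j) 'D_(delta_mx 0 i) phi y 0 j.
pose dT : 'M[R]_(k, m) :=
  \matrix_(i, j) 'D_x ('D_(delta_mx 0 i) phi) (chart_coord e p) 0 j.
have TE y : D y -> tangent_map f e c (chart_inv e y) = T y.
  move=> Dy; have [_ _ yE] := chart_invK Dy.
  rewrite /tangent_map yE; apply/matrixP => i j.
  rewrite [RHS]mxE deriveEjacobian; last exact: smooth_on_differentiable Dy.
  by rewrite -rowE [RHS]mxE.
have hT : is_derive (chart_coord e p) x T dT.
  apply/is_derive_mxP => i j; rewrite mxE.
  under [X in is_derive _ _ X _]funext do rewrite mxE.
  by have /is_derive_mxP := smooth_on_is_derive x
    (smooth_on_derive (delta_mx 0 i) sphi) Dp.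
have vT (v : 'rV[R]_k) y : D y -> v *m T y = 'D_v phi y.
  move=> Dy; rewrite deriveEjacobian; last exact: smooth_on_differentiable Dy.
  congr (_ *m _); have [_ _ yE] := chart_invK Dy.
  by rewrite -(TE _ Dy) /tangent_map yE.
have YdT : Y p *m dT = 'D_x ('D_(Y p) phi) (chart_coord e p).
  have H1 : is_derive (chart_coord e p) x (fun y => Y p *m T y)
      (0 *m T (chart_coord e p) + Y p *m dT).
    exact: (is_derive_mulmx (is_derive_cst (Y p) _ _) hT).
  rewrite mul0mx add0r in H1; rewrite -(derive_val (is_derive := H1)).
  apply: near_eq_derive; apply: filterS nD => y; exact: vT.
have Yp : (Y \o chart_inv e) (chart_coord e p) = Y p by rewrite /= coordK.
have Tp : T (chart_coord e p) = tangent_map f e c p.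
  by rewrite -(TE _ Dp) coordK.
have H := is_derive_mulmx (derivableP dY) hT.
rewrite Yp YdT Tp in H.
apply: near_eq_is_derive H; apply: filterS nD => y Dy.
by rewrite -(TE _ Dy).
Qed.

(** The second derivatives of phi in the two terms are equal by symmetry, so
    only the derivatives of the components of X and Y are left. *)
Lemma push_bracket (X Y : M -> 'rV[R]_k) p :
  chart_dom e p -> chart_dom c (f p) ->
  (forall x, derivable (X \o chart_inv e) (chart_coord e p) x) ->
  (forall x, derivable (Y \o chart_inv e) (chart_coord e p) x) ->
  dir_derive e (X p) (fun q => Y q *m tangent_map f e c q) p
  - dir_derive e (Y p) (fun q => X q *m tangent_map f e c q) p
  = lie_bracket e X Y p *m tangent_map f e c p.
Proof.
move=> ep cp dX dY; have Dp : D (chart_coord e p) by exists p.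
rewrite /dir_derive (derive_val (is_derive := is_derive_push ep cp (dY (X p)))).
rewrite (derive_val (is_derive := is_derive_push ep cp (dX (Y p)))).
have swap := smooth_on_derive_swap (X p) (Y p) oD Dp sphi.
rewrite [X in _ - (_ + X)]swap opprD addrACA subrr addr0.
by rewrite -mulmxBl.
Qed.

End Pullback.
End Charts.

(** * Bilinear forms and the Levi-Civita connection *)

Section FormVal.
Context {R : fieldType} {m : nat}.
Implicit Types (g F : 'M[R]_m) (x y : 'rV[R]_m).

Lemma form_valDl g x1 x2 y : form_val g (x1 + x2) y =
  form_val g x1 y + form_val g x2 y.
Proof. by rewrite /form_val !mulmxDl mxE. Qed.
Lemma form_valNl g x y : form_val g (- x) y = - form_val g x y.
Proof. by rewrite /form_val !mulNmx mxE. Qed.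
Lemma form_valNr g x y : form_val g x (- y) = - form_val g x y.
Proof. by rewrite /form_val linearN mulmxN mxE. Qed.
Lemma form_valZl a g x y : form_val g (a *: x) y = a * form_val g x y.
Proof. by rewrite /form_val -!scalemxAl mxE. Qed.
Lemma form_val0l g y : form_val g 0 y = 0.
Proof. by rewrite /form_val !mul0mx mxE. Qed.
Lemma form_val0r g x : form_val g x 0 = 0.
Proof. by rewrite /form_val linear0 mulmx0 mxE. Qed.
Lemma form_val_tr g x y : form_val g^T x y = form_val g y x.
Proof.
rewrite /form_val -[in RHS](trmxK (y *m g *m x^T)) [in RHS]mxE.
by rewrite !trmx_mul trmxK mulmxA.
Qed.
End FormVal.

Section LeviCivita.
Context {R : realType} {m : nat} {M : smoothManifold R m}.
Variables (g : chart M -> M -> 'M[R]_m) (c : chart M) (p : M).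

(** The Christoffel symbols as a bilinear map: the covariant derivative is the
    directional derivative plus this term. *)
Definition christoffel_map (z y : 'rV[R]_m) : 'rV[R]_m :=
  \row_l \sum_i \sum_j christoffel g c p l i j * z 0 i * y 0 j.

Hypothesis cp : chart_dom c p.
Hypothesis gsym : (g c p)^T = g c p.
Hypothesis gunit : g c p \in unitmx.
Hypothesis dg : differentiable (g c \o chart_inv c) (chart_coord c p).

(** Pairing with g cancels the inverse metric in the Christoffel symbols. The
    torsion-freeness and the compatibility with the metric are consequences of
    this identity. *)
Lemma koszul z y w :
  form_val (g c p) (christoffel_map z y) w =
  2^-1 * (form_val (dir_derive c z (g c) p) y w
          + form_val (dir_derive c y (g c) p) z w
          - form_val (dir_derive c w (g c) p) z y).
Proof.
pose d h a b := dir_derive c (delta_mx 0 h) (fun q => g c q a b) p.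
pose T (z y w : 'rV[R]_m) :=
  \sum_i \sum_j \sum_h d i j h * z 0 i * y 0 j * w 0 h.
have TE z1 y1 w1 : form_val (dir_derive c z1 (g c) p) y1 w1 = T z1 y1 w1.
  have -> : dir_derive c z1 (g c) p = \sum_h z1 0 h *: \matrix_(a, b) d h a b.
    rewrite /dir_derive deriveE// [in LHS](row_sum_delta z1) linear_sum.
    apply: eq_bigr => h _; rewrite linearZ /=; congr (_ *: _).
    apply/matrixP => a b; rewrite mxE -deriveE//.
    by have /is_derive_mxP/(_ a b)[_ <-] :=
      derivableP (diff_derivable (v := delta_mx 0 h) dg).
  rewrite /form_val mulmx_sumr mulmx_suml summxE; apply: eq_bigr => i _.
  rewrite mxE [RHS]exchange_big; apply: eq_bigr => b _; rewrite -scalemxAr !mxE.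
  rewrite mulr_sumr mulr_suml; apply: eq_bigr => a _.
  by rewrite !mxE; ring.
rewrite !TE.
pose ka : 'rV[R]_m := \row_h (2^-1 * \sum_i \sum_j
   (d i j h + d j i h - d h i j) * z 0 i * y 0 j).
have -> : christoffel_map z y = ka *m (invmx (g c p))^T.
  apply/rowP => l; rewrite !mxE.
  under eq_bigr => i _ do under eq_bigr => j _ do
    rewrite /christoffel mulr_sumr !mulr_suml.
  under [RHS]eq_bigr => h _ do rewrite !mxE mulr_sumr mulr_suml.
  rewrite [RHS]exchange_big; apply: eq_bigr => i _.
  under [RHS]eq_bigr => h _ do rewrite mulr_sumr mulr_suml.
  rewrite [RHS]exchange_big; apply: eq_bigr => j _.
  by apply: eq_bigr => h _; rewrite /d; ring.
have ginv : (invmx (g c p))^T *m g c p = 1%:M.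
  by rewrite -{2}gsym -trmx_mul mulmxV// trmx1.
rewrite /form_val -(mulmxA ka) ginv mulmx1 mxE.
under eq_bigr => h _ do rewrite !mxE -mulrA mulr_suml.
rewrite -mulr_sumr; congr (_ * _).
have -> : T y z w = \sum_i \sum_j \sum_h d j i h * z 0 i * y 0 j * w 0 h.
  rewrite /T exchange_big; apply: eq_bigr => i _; apply: eq_bigr => j _.
  by apply: eq_bigr => h _; ring.
have -> : T w z y = \sum_i \sum_j \sum_h d h i j * z 0 i * y 0 j * w 0 h.
  rewrite /T exchange_big; apply: eq_bigr => i _; rewrite exchange_big.
  by apply: eq_bigr => j _; apply: eq_bigr => h _; ring.
rewrite exchange_big -big_split -sumrB; apply: eq_bigr => i _ /=.
under eq_bigr => h _ do rewrite mulr_suml.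
rewrite exchange_big -big_split -sumrB; apply: eq_bigr => j _ /=.
rewrite -big_split -sumrB; apply: eq_bigr => h _ /=.
by rewrite /d; ring.
Qed.

End LeviCivita.

(** * Algebra of the covariant derivative of an endomorphism *)

Section EndoDerivative.
Context {R : realFieldType} {m : nat}.
Variables (g F : 'M[R]_m) (dg dF : 'rV[R]_m -> 'M[R]_m).
Variable (Gam : 'rV[R]_m -> 'rV[R]_m -> 'rV[R]_m).
Implicit Types x y z w : 'rV[R]_m.

(** The vector nabla_z (F y) - F (nabla_z y), for the field with constant
    components y. Here dF z stands for the derivative of F along z and Gam for
    the Christoffel map. Both are arbitrary maps, so that what follows is
    algebra in one tangent space. *)
Definition nabla_endo z y := y *m dF z + Gam z (y *m F) - Gam z y *m F.

(** The Nijenhuis tensor of F on the fields with constant components x and y,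
    the brackets being expanded into derivatives of F. *)
Definition nijenhuis_at x y := y *m dF (x *m F) - x *m dF (y *m F)
  + x *m dF y *m F - y *m dF x *m F.

Local Notation b := (form_val g).
Local Notation A z y w := (b (nabla_endo z y) w).

Hypothesis form_sym : forall y w, b y w = b w y.
Hypothesis dform_sym : forall z y w, form_val (dg z) y w = form_val (dg z) w y.
Hypothesis koszulG : forall z y w, b (Gam z y) w =
  2^-1 * (form_val (dg z) y w + form_val (dg y) z w - form_val (dg w) z y).
Hypothesis skewF : forall y w, b (y *m F) w = - b y (w *m F).
Hypothesis dskewF : forall z y w, form_val (dg z) (y *m F) w + b (y *m dF z) w =
  - (form_val (dg z) y (w *m F) + b y (w *m dF z)).

Lemma torsion_free z y w : b (Gam z y) w = b (Gam y z) w.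
Proof. by rewrite !koszulG (dform_sym w y z); ring. Qed.

Lemma metric_compat z y w : form_val (dg z) y w = b (Gam z y) w + b (Gam z w) y.
Proof.
by rewrite !koszulG (dform_sym z w y) (dform_sym w z y) (dform_sym y z w);
  field.
Qed.

Lemma GamN z y w : b (Gam z (- y)) w = - b (Gam z y) w.
Proof.
have H := metric_compat z (- y) w; have H' := metric_compat z y w.
by move: H; rewrite form_valNl form_valNr H'; move=> E; lra.
Qed.

Lemma nabla_endoE z y w :
  A z y w = b (y *m dF z) w + b (Gam z (y *m F)) w + b (Gam z y) (w *m F).
Proof. by rewrite form_valDl form_valNl form_valDl skewF opprK. Qed.

Lemma nabla_endo_skew z y w : A z y w = - A z w y.
Proof.
have := dskewF z y w; rewrite !nabla_endoE !metric_compat.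
rewrite (form_sym y (w *m dF z)); lra.
Qed.

(** Since the connection is torsion free, the brackets in the Nijenhuis tensor
    can be written with covariant derivatives: the Christoffel terms cancel in
    pairs. *)
Lemma nijenhuis_at_nabla x y z :
  b (nijenhuis_at x y) z = A (x *m F) y z - A (y *m F) x z + A x y (z *m F)
    - A y x (z *m F).
Proof.
rewrite !nabla_endoE !(form_valDl, form_valNl) !skewF.
rewrite (torsion_free (x *m F) (y *m F)) (torsion_free (x *m F) y).
rewrite (torsion_free x (y *m F)) (torsion_free x y); ring.
Qed.

(** On the left is, up to a factor, the exterior derivative of the fundamental
    form Phi(y,z) = g(y, F z). A torsion-free metric connection computes it, and
    then only the derivatives of F contribute. *)
Lemma fundamental_cyclic x y z :
  form_val (dg x) y (z *m F) + b y (z *m dF x)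
  + (form_val (dg y) z (x *m F) + b z (x *m dF y))
  + (form_val (dg z) x (y *m F) + b x (y *m dF z))
  = - (A x y z + A y z x + A z x y).
Proof.
rewrite !metric_compat.
rewrite (nabla_endo_skew x) (nabla_endo_skew y) (nabla_endo_skew z)
  !nabla_endoE.
rewrite !(form_sym _ (_ *m dF _)).
rewrite (torsion_free y x) (torsion_free z x) (torsion_free z y); ring.
Qed.

(* In the application [hor] is the horizontal subspace; F is an almost complex
   structure on it, up to vertical terms. *)
Variable hor : 'rV[R]_m -> Prop.
Hypothesis horF : forall y, hor y -> hor (y *m F).
Hypothesis FF : forall y, hor y -> y *m F *m F = - y.
Hypothesis dFF : forall z y w, hor y -> hor w ->
  b (y *m F *m dF z) w + b (y *m dF z *m F) w = 0.

(** Differentiating F^2 = - 1, which holds up to vertical terms, shows that F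
    anticommutes with its covariant derivative on horizontal vectors; moreover
    F is skew. *)
Lemma nabla_endo_exchange z y w : hor y -> hor w -> A z (y *m F) w =
  A z y (w *m F).
Proof.
move=> hy hw; have := dFF z hy hw.
by rewrite !nabla_endoE FF// FF// GamN form_valNr skewF; lra.
Qed.

(** As on an almost Hermitian manifold, the Nijenhuis tensor and the exterior
    derivative of the fundamental form determine the covariant derivative of F:
    written in terms of A, the right-hand side collapses by the skewness of A
    and the exchange rule. *)
Lemma nabla_endo_formula x y z : hor x -> hor y -> hor z ->
  2 * A z x y = b (nijenhuis_at x y) (z *m F)
    - (A z (x *m F) (y *m F) + A (x *m F) (y *m F) z + A (y *m F) z (x *m F))
    + (A z x y + A x y z + A y z x).
Proof.
move=> hx hy hz; rewrite nijenhuis_at_nabla FF// !form_valNr.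
rewrite (nabla_endo_exchange z hx (horF hy)) (nabla_endo_exchange _ hy hz) FF//.
rewrite -(nabla_endo_exchange _ hz hx) form_valNr
  (nabla_endo_skew (y *m F) (z *m F)).
by rewrite (nabla_endo_skew y z x); ring.
Qed.

Variables (J : 'M[R]_m) (s : 'rV[R]_m -> R).
Hypothesis JF : J *m F = - (F *m J).
Hypothesis skewJ : forall y w, b (y *m J) w = - b y (w *m J).
Hypothesis horJ : forall y, hor y -> hor (y *m J).
Hypothesis nijF : forall x y w, hor x -> hor y -> hor w ->
  b (nijenhuis_at x y) w =
  - s (y *m F) * b (x *m J *m F) w + s (x *m F) * b (y *m J *m F) w
  - s x * b (y *m J *m F *m F) w + s y * b (x *m J *m F *m F) w.
Hypothesis cyclF : forall x y z, hor x -> hor y -> hor z ->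
  A z x y + A x y z + A y z x =
  s z * b (x *m J *m F) y + s x * b (y *m J *m F) z + s y * b (z *m J *m F) x.

(** On a normal manifold both ingredients of the previous formula are
    combinations of products of s with the forms g(J.,.) and g(F J.,.). Once F
    is moved from one argument to the other, everything cancels except the term
    s(z) g(F J x, y). *)
Lemma nabla_endo_normal x y z : hor x -> hor y -> hor z ->
  A z x y = s z * b (x *m J *m F) y.
Proof.
move=> hx hy hz.
have JFx u : hor u -> u *m F *m J *m F = u *m J.
  move=> hu; rewrite -(mulmxA u) -[F *m J]opprK
    -JF mulmxN mulNmx mulmxA FF ?opprK//.
  exact: horJ.
have FFb u v : hor u -> hor v -> b (u *m F) (v *m F) = b u v.
  by move=> hu hv; rewrite skewF FF// form_valNr opprK.
have JFs u v : hor u -> hor v -> b (u *m J *m F) v = - b (v *m J *m F) u.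
  move=> hu hv; rewrite skewF skewJ opprK -mulmxA -[F *m J]opprK -JF.
  by rewrite mulmxN mulmxA form_valNr form_sym.
have JsF u v : b (u *m J) (v *m F) = - b (u *m J *m F) v by rewrite skewF opprK.
have Js u v : b (u *m J) v = - b (v *m J) u by rewrite skewJ form_sym.
have hJx := horJ hx; have hJy := horJ hy; have hJz := horJ hz.
have := nabla_endo_formula hx hy hz.
rewrite (cyclF hx hy hz) (cyclF (horF hx) (horF hy) hz).
rewrite (nijF hx hy (horF hz)) (JFx x hx) (JFx y hy) (FF hJx) (FF hJy).
rewrite (FFb _ _ hJx hz) (FFb _ _ hJy hz) (FFb _ _ hJz hx) !form_valNl !JsF.
rewrite (JFs z x)// (Js z x); lra.
Qed.

End EndoDerivative.

(** * Differentiated identities *)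

(** The way in which an identity between fields, valid near a point, is
    differentiated at that point. *)
Lemma is_derive_near_unique (R : realType) (V W : normedModType R)
    (f h : V -> W) x v df dh :
  (\forall y \near x, f y = h y) ->
  is_derive x v f df -> is_derive x v h dh -> df = dh.
Proof. by move=> fh [_ <-] [_ <-]; exact: near_eq_derive. Qed.

Lemma is_derive_covec (R : realType) (V : normedModType R) m
    (w : V -> 'cV[R]_m) dw (y : 'rV[R]_m) x v :
  is_derive x v w dw -> is_derive x v (fun q => covec_val (w q) y)
    (covec_val dw y).
Proof.
move=> hw; have /is_derive_mxP/(_ 0 0) :=
  is_derive_mulmx (is_derive_cst y x v) hw.
by rewrite mul0mx add0r.
Qed.

Section DerivedIdentities.
Context {R : realType} {V : normedModType R} {m : nat}.
Variables (x v : V) (g F : V -> 'M[R]_m) (dg dF : 'M[R]_m).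
Hypothesis hg : is_derive x v g dg.
Hypothesis hF : is_derive x v F dF.

Lemma is_derive_fundamental y w :
  is_derive x v (fun q => form_val (g q) y (w *m F q))
    (form_val dg y (w *m F x) + form_val (g x) y (w *m dF)).
Proof.
have := is_derive_form hg (is_derive_cst y x v)
  (is_derive_mulmx (is_derive_cst w x v) hF).
by rewrite form_val0l mul0mx add0r addr0.
Qed.

Lemma is_derive_form_sym :
  (\forall q \near x, (g q)^T = g q) -> dg^T = dg.
Proof. by move=> E; exact: is_derive_near_unique E (is_derive_trmx hg) hg. Qed.

Lemma is_derive_form_skew y w :
  (\forall q \near x, form_val (g q) (y *m F q) w =
    - form_val (g q) y (w *m F q)) ->
  form_val dg (y *m F x) w + form_val (g x) (y *m dF) w
  = - (form_val dg y (w *m F x) + form_val (g x) y (w *m dF)).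
Proof.
move=> E; have hl := is_derive_form hg
  (is_derive_mulmx (is_derive_cst y x v) hF) (is_derive_cst w x v).
rewrite form_val0r mul0mx add0r addr0 in hl.
exact: is_derive_near_unique E hl (is_deriveN (is_derive_fundamental y w)).
Qed.

Lemma is_derive_sqr (a b : V -> 'cV[R]_m) (A B : V -> 'rV[R]_m) da db dA dB :
  is_derive x v a da -> is_derive x v b db ->
  is_derive x v A dA -> is_derive x v B dB ->
  (\forall q \near x, F q *m F q = - 1%:M + a q *m A q + b q *m B q) ->
  F x *m dF + dF *m F x = da *m A x + a x *m dA + (db *m B x + b x *m dB).
Proof.
move=> ha hb hA hB E; rewrite addrC.
have hr := is_deriveD (is_deriveD (is_derive_cst (- 1%:M : 'M[R]_m) x v)
  (is_derive_mulmx ha hA)) (is_derive_mulmx hb hB).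
have := is_derive_near_unique E (is_derive_mulmx hF hF) hr.
by rewrite add0r.
Qed.

End DerivedIdentities.

Section ClosedForm.
Context {R : realType} {m : nat}.
Variables (D : set 'rV[R]_m) (x0 : 'rV[R]_m).
Variables (Phi : 'rV[R]_m -> 'rV[R]_m -> 'rV[R]_m -> R).
Variables (dPhi : 'rV[R]_m -> 'rV[R]_m -> 'rV[R]_m -> R).
Variables (w t : 'rV[R]_m -> 'cV[R]_m) (s : 'rV[R]_m -> 'rV[R]_m -> R).
Hypotheses (oD : open D) (Dx0 : D x0) (sw : smooth_on D w)
  (dt0 : forall v, derivable t x0 v).
Hypothesis hPhi : forall x y z, is_derive x0 x (fun q => Phi q y z)
  (dPhi x y z).

Definition ext_d_at (w : 'rV[R]_m -> 'cV[R]_m) q y z : R :=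
  2^-1 * ('D_y (fun q => covec_val (w q) z) q
    - 'D_z (fun q => covec_val (w q) y) q).

Hypothesis dwE : forall q, D q -> forall y z,
  ext_d_at w q y z = Phi q y z
    + 2^-1 * (s q y * covec_val (t q) z - s q z * covec_val (t q) y).

(** Let B be the 2-form s /\ t, so that Phi = dw - B. The cyclic sum of the
    derivatives of dw is 0 because second derivatives are symmetric. For B, one
    differentiates the algebraic identity B /\ t = 0, evaluated on T0 and two
    vectors that t kills at x0: this expresses the derivative of B by s and dt,
    without any derivative of s. *)
Lemma cyclic_derivative T0 x y z : covec_val (t x0) T0 = 1 ->
  covec_val (t x0) x = 0 -> covec_val (t x0) y = 0 -> covec_val (t x0) z = 0 ->
  dPhi x y z + dPhi y z x + dPhi z x y =
  - (s x0 y * ext_d_at t x0 x z + s x0 z * ext_d_at t x0 y x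
     + s x0 x * ext_d_at t x0 z y).
Proof.
move=> tT.
have nD : \forall q \near x0, D q := open_nbhs_nbhs (conj oD Dx0).
have [W Wsym hW] : exists2 W : 'rV[R]_m -> 'rV[R]_m -> 'rV[R]_m -> R,
    forall a c d, W a c d = W c a d &
    forall a c d, is_derive x0 a
      (fun q => 'D_c (fun q => covec_val (w q) d) q) (W a c d).
  exists (fun a c d => covec_val ('D_a ('D_c w) x0) d) => a c d.
    by rewrite (smooth_on_derive_swap c a oD Dx0 sw).
  have h := is_derive_covec d (smooth_on_is_derive a (smooth_on_derive c sw)
    Dx0).
  apply: near_eq_is_derive h; apply: filterS nD => q Dq.
  by have [_ <-] := is_derive_covec d (smooth_on_is_derive c sw Dq).
have [dt ht] : exists dt : 'rV[R]_m -> 'rV[R]_m -> R, forall a d,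
    is_derive x0 a (fun q => covec_val (t q) d) (dt a d).
  exists (fun a d => covec_val ('D_a t x0) d) => a d.
  exact: is_derive_covec (derivableP (@dt0 a)).
have dtE a d : ext_d_at t x0 a d = 2^-1 * (dt a d - dt d a).
  by rewrite /ext_d_at; have [_ ->] := ht a d; have [_ ->] := ht d a.
pose B q a d := ext_d_at w q a d - Phi q a d.
pose dB a c d := 2^-1 * (W a c d - W a d c) - dPhi a c d.
have hB a c d : is_derive x0 a (fun q => B q c d) (dB a c d).
  exact: is_deriveB (is_deriveZ 2^-1 (is_deriveB (hW a c d) (hW a d c)))
    (hPhi a c d).
have BE q : D q -> forall c d, B q c d =
    2^-1 * (s q c * covec_val (t q) d - s q d * covec_val (t q) c).
  by move=> Dq c d; rewrite /B dwE// addrC addKr.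
have dBE a c d : covec_val (t x0) c = 0 -> covec_val (t x0) d = 0 ->
    dB a c d = 2^-1 * (s x0 c * dt a d - s x0 d * dt a c).
  move=> tc td.
  (* The identity B /\ t = 0 on the vectors c, d and T0. *)
  have E : \forall q \near x0,
      B q c d * covec_val (t q) T0 + B q d T0 * covec_val (t q) c
      + B q T0 c * covec_val (t q) d = 0.
    by apply: filterS nD => q Dq; rewrite !BE//; ring.
  have := is_derive_near_unique E
    (is_deriveD (is_deriveD (is_deriveM (hB a c d) (ht a T0))
       (is_deriveM (hB a d T0) (ht a c))) (is_deriveM (hB a T0 c) (ht a d)))
    (is_derive_cst (0 : R) x0 a).
  rewrite !(BE _ Dx0) tT tc td /GRing.scale /=.
  by move: (dB _ _ _) (dB _ _ _) (dB _ _ _) => d1 d2 d3 H; lra.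
move=> tx ty tz; rewrite !dtE.
move: (dBE x y z ty tz) (dBE y z x tz tx) (dBE z x y tx ty).
rewrite /dB (Wsym y x) (Wsym z x) (Wsym z y) => E1 E2 E3; lra.
Qed.

End ClosedForm.

(** * Indefinite complex contact manifolds *)

Lemma orthP (R : fieldType) m s (g : 'M[R]_m) (A : 'M[R]_(s, m))
    (x : 'rV[R]_m) :
  (x <= orth g A)%MS <->
  (forall y : 'rV[R]_m, (y <= A)%MS -> form_val g x y = 0).
Proof.
split=> [/sub_kermxP H y /submxP[B ->]|H].
  by rewrite /form_val trmx_mul mulmxA -(mulmxA x) H mul0mx mxE.
apply/sub_kermxP/rowP => j; rewrite mulmxA [RHS]mxE
  -(H (row j A) (row_sub _ _)).
by rewrite /form_val tr_row colE mulmxA -colE [RHS]mxE.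
Qed.

Lemma stdJ_sqr (F : pzRingType) N : stdJ F N *m stdJ F N = - 1%:M.
Proof.
rewrite /stdJ mulmx_block !mul0mx !mulmx0 !mulmx1 !add0r !addr0 mul1mx.
by rewrite (scalar_mx_block N N 1) opp_block_mx !oppr0.
Qed.

Lemma rV1_mul (R : pzRingType) k (Z : 'M[R]_1) (u : 'rV[R]_k) : Z *m u =
  Z 0 0 *: u.
Proof. by rewrite {1}(mx11_scalar Z) mul_scalar_mx. Qed.

(** A field with constant components has zero derivative, so that the bracket
    of x with F y is the derivative of F y along x. *)
Lemma nijenhuis_atE (R : realType) m (M : smoothManifold R m)
    (F : chart M -> M -> 'M[R]_m) (c : chart M) (p : M) dF x y :
  (forall z, is_derive (chart_coord c p) z (F c \o chart_inv c) (dF z)) ->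
  nijenhuis F c p x y = nijenhuis_at (F c p) dF x y.
Proof.
move=> hF.
have dcst z (w : 'rV[R]_m) : dir_derive c z (fun _ : M => w) p = 0.
  exact: derive_cst.
have dmul z (w : 'rV[R]_m) : dir_derive c z (fun q => w *m F c q) p = w *m dF z.
  have [_] := is_derive_mulmx (is_derive_cst w (chart_coord c p) z) (hF z).
  by rewrite mul0mx add0r.
rewrite /nijenhuis /lie_bracket /nijenhuis_at !dcst !dmul.
by rewrite !(subr0, sub0r, mul0mx, add0r, mulNmx, opprK) addrAC.
Qed.

Section ContactIdentities.
Context {R : realType} {n q : nat} {Mb : complexContactManifold R n q}.
Variables (i : contact_patch Mb) (c : chart Mb).
Local Notation m := (cdim n + cdim n)%N.
Local Notation J := (stdJ R (cdim n)).
Local Notation b p := (form_val (met c p)).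
Local Notation x0 p := (chart_coord c p).

(** The coordinates, in the chart c, of the points where the local forms and
    tensors of the patch i are defined. *)
Definition contact_dom : set 'rV[R]_m :=
  chart_coord c @` (patch_dom i `&` (fun p : Mb => p) @^-1` chart_dom c `&`
    chart_dom c).

Lemma contact_dom_open : open contact_dom.
Proof.
by apply: chart_image_open; apply: openI; [exact: pdom_open | exact: dom_open].
Qed.

Lemma contact_domP y : contact_dom y ->
  patch_dom i (chart_inv c y) /\ chart_dom c (chart_inv c y).
Proof. by move=> /chart_invK[[? ?] ? _]. Qed.

Lemma smooth_met : smooth_on contact_dom (met c \o chart_inv c).
Proof.
move=> vs y [p [[ip cp] cp'] <-]; apply: ((met_tensor Mb).1 c c vs).
by exists p.
Qed.

Lemma smooth_on_patch (W : normedModType R) (f : chart Mb -> Mb -> W) :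
  smooth_components (fun p : Mb => p) (patch_dom i) f ->
  smooth_on contact_dom (f c \o chart_inv c).
Proof. by move=> sf; exact: sf c c. Qed.

Variable p : Mb.
Hypotheses (ip : patch_dom i p) (cp : chart_dom c p).
Local Notation U := (Ufield i c p).
Local Notation V := (Vfield i c p).

Lemma contact_dom_pt : contact_dom (x0 p).
Proof. by exists p. Qed.

Lemma met_formC x y : b p x y = b p y x.
Proof. by rewrite -form_val_tr met_sym. Qed.

Lemma stdJ_skew x y : b p (x *m J) y = - b p x (y *m J).
Proof.
have JJ x1 y1 : b p (x1 *m J) (y1 *m J) = b p x1 y1.
  by rewrite /form_val trmx_mul !mulmxA -(mulmxA x1) -(mulmxA x1) met_hermitian.
rewrite -(JJ x (y *m J)) -mulmxA stdJ_sqr mulmxN mulmx1 form_valNr opprK //.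
Qed.

Lemma stdJ_stdJ (x : 'rV[R]_m) : x *m J *m J = - x.
Proof. by rewrite -mulmxA stdJ_sqr mulmxN mulmx1. Qed.

Lemma UJ : U *m J = - V.
Proof. by rewrite (Vfield_def ip cp) opprK. Qed.

Lemma VJ : V *m J = U.
Proof. by rewrite (Vfield_def ip cp) mulNmx stdJ_stdJ opprK. Qed.

Lemma uformE y : covec_val (uform i c p) y = b p U y.
Proof. by rewrite (Ufield_dual ip cp). Qed.

Lemma vformE y : covec_val (vform i c p) y = b p V y.
Proof.
rewrite /covec_val (vform_def ip cp) mulmxA -/(covec_val _ _) uformE.
by rewrite met_formC stdJ_skew met_formC UJ form_valNl opprK.
Qed.

Lemma horizontalP x : horizontal i c p x <-> b p U x = 0 /\ b p V x = 0.
Proof.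
rewrite /horizontal orthP; split=> [H|[Ux Vx] y].
  by rewrite ![b p _ x]met_formC !H ?addsmxSl ?addsmxSr.
case/sub_addsmxP=> -[X Y] /= ->; rewrite met_formC form_valDl.
by rewrite !rV1_mul !form_valZl Ux Vx !mulr0 addr0.
Qed.

Lemma horizontal_stdJ x : horizontal i c p x -> horizontal i c p (x *m J).
Proof.
move=> /horizontalP[Ux Vx]; apply/horizontalP.
have E W : b p W (x *m J) = - b p (W *m J) x by rewrite stdJ_skew opprK.
by rewrite !E UJ VJ form_valNl Vx Ux !oppr0.
Qed.

Lemma uform_horizontal x : horizontal i c p x -> x *m uform i c p = 0.
Proof.
move=> /horizontalP[Ux _].
by apply/matrixP => a a'; rewrite !ord1 [RHS]mxE -Ux -uformE.
Qed.

Lemma vform_horizontal x : horizontal i c p x -> x *m vform i c p = 0.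
Proof.
move=> /horizontalP[_ Vx].
by apply/matrixP => a a'; rewrite !ord1 [RHS]mxE -Vx -vformE.
Qed.

Lemma sqr_horizontal (F : 'M[R]_m) x :
  F *m F = - 1%:M + uform i c p *m U + vform i c p *m V ->
  horizontal i c p x -> x *m F *m F = - x.
Proof.
move=> FF hx; rewrite -mulmxA FF !mulmxDr mulmxN mulmx1 !mulmxA.
by rewrite uform_horizontal// vform_horizontal// !mul0mx !addr0.
Qed.

(* G and H are treated together: (F, w, t, T0) is (G, u, v, V) or
   (H, v, - u, - U), and s is sigma in both cases. *)
Section EndoNormal.
Variables (F : chart Mb -> Mb -> 'M[R]_m) (w t : chart Mb -> Mb -> 'cV[R]_m).
Variables (s : Mb -> 'rV[R]_m -> R) (T0 : 'rV[R]_m) (dF : 'rV[R]_m -> 'M[R]_m).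
Hypothesis sw : smooth_on contact_dom (w c \o chart_inv c).
Hypothesis dt0 : forall z, derivable (t c \o chart_inv c) (x0 p) z.
Hypothesis skewF : forall r, patch_dom i r -> chart_dom c r -> forall y z,
  b r (y *m F c r) z = - b r y (z *m F c r).
Hypothesis sqrF : forall r, patch_dom i r -> chart_dom c r ->
  F c r *m F c r = - 1%:M + uform i c r *m Ufield i c r
    + vform i c r *m Vfield i c r.
Hypotheses (UF : U *m F c p = 0) (VF : V *m F c p = 0).
Hypothesis JF : J *m F c p = - (F c p *m J).
Hypothesis dwE : forall r, patch_dom i r -> chart_dom c r -> forall y z,
  ext_d w c r y z = b r y (z *m F c r) + wedge11 (s r) (covec_val (t c r)) y z.
Hypothesis tT0 : covec_val (t c p) T0 = 1.
Hypothesis t_hor : forall y, horizontal i c p y -> covec_val (t c p) y = 0.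
Hypothesis dtE : forall y z, horizontal i c p y -> horizontal i c p z ->
  ext_d t c p y z = b p y (z *m J *m F c p).
Hypothesis nijF : forall x y z, horizontal i c p x -> horizontal i c p y ->
  horizontal i c p z -> b p (nijenhuis F c p x y) z =
  - s p (y *m F c p) * b p (x *m J *m F c p) z
  + s p (x *m F c p) * b p (y *m J *m F c p) z
  - s p x * b p (y *m J *m F c p *m F c p) z
  + s p y * b p (x *m J *m F c p *m F c p) z.
Hypothesis hdF : forall z, is_derive (x0 p) z (F c \o chart_inv c) (dF z).

(** The structure equation dw = Phi + s /\ t yields the exterior derivative of
    the fundamental form, the normality condition yields the Nijenhuis tensor,
    and [nabla_endo_normal] combines them. *)
Lemma contact_endo_normal x y z :
  horizontal i c p x -> horizontal i c p y -> horizontal i c p z ->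
  b p (nabla_endo (F c p) dF (christoffel_map met c p) z x) y
  = s p z * b p (x *m J *m F c p) y.
Proof.
have at_p (W : Type) (f : Mb -> W) : (f \o chart_inv c) (x0 p) = f p.
  by rewrite /= coordK.
have nD : \forall r \near x0 p, contact_dom r.
  exact: open_nbhs_nbhs (conj contact_dom_open contact_dom_pt).
have [dg hdg] : exists dg : 'rV[R]_m -> 'M[R]_m,
    forall z, is_derive (x0 p) z (met c \o chart_inv c) (dg z).
  exists (fun z => dir_derive c z (met c) p) => v.
  exact: smooth_on_is_derive smooth_met contact_dom_pt.
have dgE v : dir_derive c v (met c) p = dg v by have [_ <-] := hdg v.
have dform_sym v y1 w1 : form_val (dg v) y1 w1 = form_val (dg v) w1 y1.
  rewrite -[in RHS](is_derive_form_sym (hdg v)) ?form_val_tr//.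
  by apply: filterS nD => r /contact_domP[_ cr]; rewrite /= met_sym.
have koszulG v y1 w1 : b p (christoffel_map met c p v y1) w1 =
    2^-1 * (form_val (dg v) y1 w1 + form_val (dg y1) v w1
      - form_val (dg w1) v y1).
  rewrite koszul ?dgE//; [exact: met_sym | exact: met_nondeg |].
  exact: smooth_on_differentiable smooth_met contact_dom_pt.
have dskewF v y1 w1 : form_val (dg v) (y1 *m F c p) w1 + b p (y1 *m dF v) w1 =
    - (form_val (dg v) y1 (w1 *m F c p) + b p y1 (w1 *m dF v)).
  have := @is_derive_form_skew _ _ _ _ _ _ _ _ _ (hdg v) (hdF v) y1 w1.
  rewrite (at_p _ (F c)) (at_p _ (met c)); apply.
  by apply: filterS nD => r /contact_domP[ir cr]; exact: skewF.
have skewFp := skewF ip cp.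
have FF u : horizontal i c p u -> u *m F c p *m F c p = - u.
  exact: sqr_horizontal (sqrF ip cp).
have horF u : horizontal i c p u -> horizontal i c p (u *m F c p).
  move=> _; apply/horizontalP.
  have E W : b p W (u *m F c p) = - b p (W *m F c p) u by rewrite skewFp opprK.
  by rewrite !E UF VF form_val0l oppr0.
have smu := smooth_on_is_derive _ (smooth_on_patch (uform_form i).1)
  contact_dom_pt.
have smv := smooth_on_is_derive _ (smooth_on_patch (vform_form i).1)
  contact_dom_pt.
have smU := smooth_on_is_derive _ (smooth_on_patch (Ufield_field i).1)
  contact_dom_pt.
have smV := smooth_on_is_derive _ (smooth_on_patch (Vfield_field i).1)
  contact_dom_pt.
have dFF v y1 w1 : horizontal i c p y1 -> horizontal i c p w1 ->
    b p (y1 *m F c p *m dF v) w1 + b p (y1 *m dF v *m F c p) w1 = 0.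
  move=> hy hw; have /horizontalP[Uw Vw] := hw.
  have sq : \forall r \near x0 p,
      (F c \o chart_inv c) r *m (F c \o chart_inv c) r =
      - 1%:M + (uform i c \o chart_inv c) r *m (Ufield i c \o chart_inv c) r
      + (vform i c \o chart_inv c) r *m (Vfield i c \o chart_inv c) r.
    by apply: filterS nD => r /contact_domP[ir cr]; exact: sqrF.
  have := is_derive_sqr (hdF v) (smu v) (smv v) (smU v) (smV v) sq.
  move: ('D_v _ _) ('D_v _ _) ('D_v _ _) ('D_v _ _) => du dU dv dV.
  rewrite !at_p => E; rewrite -form_valDl -!mulmxA -mulmxDr E !mulmxDr.
  rewrite (mulmxA y1 (uform _ _ _)) (mulmxA y1 (vform _ _ _)) uform_horizontal//
    vform_horizontal//.
  rewrite !mul0mx !addr0 !mulmxA form_valDl.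
  by rewrite !(rV1_mul (y1 *m _)) !form_valZl Uw Vw !mulr0 addr0.
have [Phi0 hPhi] : exists dPhi : 'rV[R]_m -> 'rV[R]_m -> 'rV[R]_m -> R,
    forall a y1 z1, dPhi a y1 z1 = form_val (dg a) y1 (z1 *m F c p)
                                   + b p y1 (z1 *m dF a).
  by eexists; move=> a y1 z1; reflexivity.
have hPhi1 a y1 z1 : is_derive (x0 p) a
    (fun r => form_val ((met c \o chart_inv c) r) y1
      (z1 *m (F c \o chart_inv c) r))
    (Phi0 a y1 z1).
  have := is_derive_fundamental (hdg a) (hdF a) y1 z1.
  by rewrite hPhi !at_p.
have cyclF x1 y1 z1 :
    horizontal i c p x1 -> horizontal i c p y1 -> horizontal i c p z1 ->
    b p (nabla_endo (F c p) dF (christoffel_map met c p) z1 x1) y1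
    + b p (nabla_endo (F c p) dF (christoffel_map met c p) x1 y1) z1
    + b p (nabla_endo (F c p) dF (christoffel_map met c p) y1 z1) x1
    = s p z1 * b p (x1 *m J *m F c p) y1 + s p x1 * b p (y1 *m J *m F c p) z1
      + s p y1 * b p (z1 *m J *m F c p) x1.
  move=> hx hy hz.
  have dwE1 r : contact_dom r -> forall y2 z2,
      ext_d_at (w c \o chart_inv c) r y2 z2
      = form_val ((met c \o chart_inv c) r) y2 (z2 *m (F c \o chart_inv c) r)
      + 2^-1 * (s (chart_inv c r) y2 * covec_val ((t c \o chart_inv c) r) z2
                - s (chart_inv c r) z2 * covec_val ((t c \o chart_inv c) r) y2).
    move=> Dr y2 z2; have [_ _ rE] := chart_invK Dr.
    have [ir cr] := contact_domP Dr.
    by have := dwE ir cr y2 z2; rewrite /ext_d /dir_derive rE.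
  have dtE1 y2 z2 : horizontal i c p y2 -> horizontal i c p z2 ->
      ext_d_at (t c \o chart_inv c) (x0 p) y2 z2 = b p y2 (z2 *m J *m F c p).
    exact: dtE.
  have tp : (t c \o chart_inv c) (x0 p) = t c p by exact: at_p.
  have := cyclic_derivative contact_dom_open contact_dom_pt sw dt0 hPhi1 dwE1
    (T0 := T0) (x := x1) (y := y1) (z := z1).
  rewrite tp => /(_ tT0 (t_hor hx) (t_hor hy) (t_hor hz)).
  rewrite !dtE1// !hPhi => E.
  have := fundamental_cyclic met_formC dform_sym koszulG skewFp dskewF x1 y1 z1.
  rewrite E coordK// (met_formC x1 (z1 *m J *m F c p)).
  rewrite (met_formC y1 (x1 *m J *m F c p)) (met_formC z1 (y1 *m J *m F c p)).
  move=> E'; lra.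
move=> hx hy hz.
have nijF' x1 y1 z1 : horizontal i c p x1 -> horizontal i c p y1 ->
  horizontal i c p z1 -> b p (nijenhuis_at (F c p) dF x1 y1) z1 =
  - s p (y1 *m F c p) * b p (x1 *m J *m F c p) z1
  + s p (x1 *m F c p) * b p (y1 *m J *m F c p) z1
  - s p x1 * b p (y1 *m J *m F c p *m F c p) z1
  + s p y1 * b p (x1 *m J *m F c p *m F c p) z1.
  by move=> ? ? ?; rewrite -(nijenhuis_atE _ _ hdF) nijF.
exact: (nabla_endo_normal met_formC dform_sym koszulG skewFp dskewF horF FF dFF
  JF stdJ_skew horizontal_stdJ nijF' cyclF hx hy hz).
Qed.
End EndoNormal.

End ContactIdentities.

(** * Covariant derivatives of G, H and J on a normal manifold *)

Lemma covec_valN (R : fieldType) m (w : 'cV[R]_m) x : covec_val (- w) x =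
  - covec_val w x.
Proof. by rewrite /covec_val mulmxN mxE. Qed.

Section NormalContact.
Context {R : realType} {n q : nat} {Mb : complexContactManifold R n q}.
Hypothesis normal : normal_contact Mb.
Variables (i : contact_patch Mb) (c : chart Mb).
Local Notation m := (cdim n + cdim n)%N.
Local Notation J := (stdJ R (cdim n)).
Local Notation b p := (form_val (met c p)).
Local Notation x0 p := (chart_coord c p).

Lemma Hten_skew p : patch_dom i p -> chart_dom c p -> forall y z,
  b p (y *m Hten i c p) z = - b p y (z *m Hten i c p).
Proof.
move=> ip cp y z; rewrite (Hten_def ip cp) mulmxA (Gten_skew ip cp) stdJ_skew//.
by rewrite opprK (GJ_anticomm ip cp) mulmxN mulmxA form_valNr opprK.
Qed.

Lemma stdJ_Hten p : patch_dom i p -> chart_dom c p -> J *m Hten i c p =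
  - Gten i c p.
Proof.
by move=> ip cp; rewrite (Hten_def ip cp) mulmxA stdJ_sqr mulNmx mul1mx.
Qed.

Variable p : Mb.
Hypotheses (ip : patch_dom i p) (cp : chart_dom c p).
Local Notation U := (Ufield i c p).
Local Notation V := (Vfield i c p).
Local Notation G := (Gten i c p).
Local Notation H := (Hten i c p).
Local Notation hor := (horizontal i c p).

Lemma Hten_stdJ : H *m J = G.
Proof.
rewrite (Hten_def ip cp) -mulmxA -[G *m J]opprK -(GJ_anticomm ip cp).
by rewrite mulmxN mulmxA stdJ_sqr mulNmx mul1mx opprK.
Qed.

Lemma mul_stdJ_Gten (x : 'rV[R]_m) : x *m J *m G = x *m H.
Proof. by rewrite (Hten_def ip cp) mulmxA. Qed.

Lemma mul_stdJ_Hten (x : 'rV[R]_m) : x *m J *m H = - (x *m G).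
Proof. by rewrite -mulmxA stdJ_Hten// mulmxN. Qed.

Lemma Gten_V : V *m G = 0.
Proof.
by rewrite (Vfield_def ip cp) mulNmx -mulmxA (GJ_anticomm ip cp) mulmxN mulmxA
  (Gten_U ip cp) mul0mx !oppr0.
Qed.

Lemma Hten_U : U *m H = 0.
Proof. by rewrite (Hten_def ip cp) mulmxA UJ// mulNmx Gten_V oppr0. Qed.

Lemma Hten_V : V *m H = 0.
Proof. by rewrite (Hten_def ip cp) mulmxA VJ// (Gten_U ip cp). Qed.

Lemma Gten_Hten (x : 'rV[R]_m) : x *m G *m H = - (x *m H *m G).
Proof.
rewrite (Hten_def ip cp) -(mulmxA x) (mulmxA G) -[G *m J]opprK
  -(GJ_anticomm ip cp).
by rewrite mulNmx mulmxN -!mulmxA.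
Qed.

Lemma form_UU : b p U U = 1.
Proof. by rewrite -uformE// (uform_Ufield ip cp). Qed.

Lemma form_VV : b p V V = 1.
Proof.
by rewrite -form_UU -(VJ ip cp) stdJ_skew// stdJ_stdJ form_valNr opprK.
Qed.

Lemma covec_uform_horizontal y : hor y -> covec_val (uform i c p) y = 0.
Proof. by move=> hy; rewrite /covec_val uform_horizontal// mxE. Qed.

Lemma covec_vform_horizontal y : hor y -> covec_val (vform i c p) y = 0.
Proof. by move=> hy; rewrite /covec_val vform_horizontal// mxE. Qed.

(** Horizontal vectors are killed by u and v, so that dv reduces to g(., H .)
    and the condition S = 0 to the value of the Nijenhuis tensor of G. *)
Lemma nabla_Gten_horizontal dG x y z :
  (forall z, is_derive (x0 p) z (Gten i c \o chart_inv c) (dG z)) ->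
  hor x -> hor y -> hor z ->
  b p (nabla_endo G dG (christoffel_map met c p) z x) y
  = sigma i c p z * b p (x *m H) y.
Proof.
move=> hG hx hy hz; rewrite -mul_stdJ_Gten.
apply: (@contact_endo_normal _ _ _ _ i c p ip cp (Gten i) (uform i) (vform i)
  (sigma i c) V dG); [.. | exact: hx | exact: hy | exact: hz].
- exact: smooth_on_patch (uform_form i).1.
- move=> v; apply/diff_derivable.
  exact: smooth_on_differentiable (smooth_on_patch (vform_form i).1)
    (contact_dom_pt ip cp).
- by move=> r ir cr y1 z1; exact: Gten_skew.
- by move=> r ir cr; exact: Gten_sqr.
- exact: Gten_U.
- exact: Gten_V.
- exact: GJ_anticomm.
- by move=> r ir cr y1 z1; exact: d_uform.
- by rewrite vformE// form_VV.
- exact: covec_vform_horizontal.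
- move=> y1 z1 hy1 hz1; rewrite d_vform// /wedge11 !covec_uform_horizontal//.
  by rewrite !mulr0 subrr mulr0 subr0 mul_stdJ_Gten.
move=> x1 y1 z1 hx1 hy1 /(horizontalP i cp)[Uz Vz].
have [/(_ x1 y1 hx1 hy1)[+ _] _] := normal ip cp.
rewrite /tensorS; move: (nijenhuis _ _ _ _ _) => N0 /=;
  rewrite !covec_vform_horizontal// !scale0r subrr scaler0 addr0 !mul_stdJ_Gten.
move/(congr1 (fun X => b p X z1)).
rewrite !(form_valDl, form_valNl, form_valZl) form_val0l Uz Vz => E; lra.
Qed.

(** The condition T = 0 plays for H the role of S = 0 for G, with (v, - u) in
    place of (u, v); the sign comes from H J = - G, where J acts first. *)
Lemma nabla_Hten_horizontal dH x y z :
  (forall z, is_derive (x0 p) z (Hten i c \o chart_inv c) (dH z)) ->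
  hor x -> hor y -> hor z ->
  b p (nabla_endo H dH (christoffel_map met c p) z x) y
  = - sigma i c p z * b p (x *m G) y.
Proof.
move=> hH hx hy hz.
have -> : - sigma i c p z * b p (x *m G) y =
  sigma i c p z * b p (x *m J *m H) y.
  by rewrite mul_stdJ_Hten form_valNl mulrN mulNr.
apply: (@contact_endo_normal _ _ _ _ i c p ip cp (Hten i) (vform i)
  (fun c r => - uform i c r) (sigma i c) (- U) dH);
  [.. | exact: hx | exact: hy | exact: hz].
- exact: smooth_on_patch (vform_form i).1.
- move=> v; apply/derivableN/diff_derivable.
  exact: smooth_on_differentiable (smooth_on_patch (uform_form i).1)
    (contact_dom_pt ip cp).
- by move=> r ir cr y1 z1; exact: Hten_skew.
- by move=> r ir cr; exact: Hten_sqr.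
- exact: Hten_U.
- exact: Hten_V.
- by rewrite stdJ_Hten// Hten_stdJ.
- move=> r ir cr y1 z1; rewrite d_vform// /wedge11 !covec_valN.
  by rewrite -/(sigma _ _ _); ring.
- by rewrite covec_valN uformE// form_valNr form_UU opprK.
- by move=> y1 hy1; rewrite covec_valN covec_uform_horizontal// oppr0.
- move=> y1 z1 hy1 hz1.
  have -> : ext_d (fun c r => - uform i c r) c p y1 z1 =
    - ext_d (uform i) c p y1 z1.
    have hu v : is_derive (x0 p) v (uform i c \o chart_inv c)
        (dir_derive c v (uform i c) p).
      exact: smooth_on_is_derive (smooth_on_patch (uform_form i).1)
        (contact_dom_pt ip cp).
    have hd v y2 : dir_derive c v (fun r => covec_val (- uform i c r) y2) p
                   = - dir_derive c v (fun r => covec_val (uform i c r) y2) p.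
      have [_ E1] := is_derive_covec y2 (hu v).
      have [_ E2] := is_derive_covec y2 (is_deriveN (hu v)).
      by rewrite [LHS]E2 covec_valN; congr (- _); exact: esym E1.
    by rewrite /ext_d !hd; ring.
  rewrite d_uform// /wedge11 !covec_vform_horizontal//.
  by rewrite !mulr0 subrr mulr0 addr0 mul_stdJ_Hten form_valNr.
move=> x1 y1 z1 hx1 hy1 /(horizontalP i cp)[Uz Vz].
have [/(_ x1 y1 hx1 hy1)[_ +] _] := normal ip cp.
rewrite /tensorT; move: (nijenhuis _ _ _ _ _) => N0 /=;
  rewrite !covec_uform_horizontal// !scale0r subrr scaler0 addr0 !mul_stdJ_Hten.
rewrite !mulNmx !Gten_Hten !opprK.
move/(congr1 (fun X => b p X z1)).
rewrite !(form_valDl, form_valNl, form_valZl) form_val0l Uz Vz => E; lra.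
Qed.

Lemma horizontal_Gten y : hor (y *m G).
Proof.
have E W : b p W (y *m G) = - b p (W *m G) y by rewrite (Gten_skew ip cp) opprK.
by apply/(horizontalP i cp); rewrite !E (Gten_U ip cp) Gten_V form_val0l oppr0.
Qed.

(** Since H is J followed by G, the image under G of (nabla_z J) x is
    (nabla_z H) x - (nabla_z G) (J x). By the formulas for G and H the two terms
    agree against horizontal vectors, on which G is invertible. *)
Lemma nabla_stdJ_horizontal x y z : hor x -> hor y -> hor z ->
  b p (nabla_endo J (fun _ => 0) (christoffel_map met c p) z x) y = 0.
Proof.
move=> hx hy hz.
have hG v : is_derive (x0 p) v (Gten i c \o chart_inv c)
  (dir_derive c v (Gten i c) p).
  exact: smooth_on_is_derive (smooth_on_patch (Gten_tensor i).1)
    (contact_dom_pt ip cp).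
have [dG {}hG] : exists dG : 'rV[R]_m -> 'M[R]_m,
    forall v, is_derive (x0 p) v (Gten i c \o chart_inv c) (dG v).
  by eexists; exact: hG.
have hH v : is_derive (x0 p) v (Hten i c \o chart_inv c) (J *m dG v).
  have := is_derive_mulmx (is_derive_cst J _ _) (hG v).
  rewrite mul0mx add0r; apply: near_eq_is_derive.
  apply: filterS (open_nbhs_nbhs (conj (@contact_dom_open _ _ _ _ i c)
    (contact_dom_pt ip cp))).
  by move=> r /contact_domP[ir cr]; rewrite /= Hten_def.
have key : nabla_endo H (fun v => J *m dG v) (christoffel_map met c p) z x =
    nabla_endo G dG (christoffel_map met c p) z (x *m J)
    + nabla_endo J (fun _ => 0) (christoffel_map met c p) z x *m G.
  rewrite /nabla_endo mulmx0 add0r mulmxBl -!mulmxA -(Hten_def ip cp).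
  by rewrite addrA subrK.
have hyG := horizontal_Gten y.
have := nabla_Hten_horizontal hH hx hyG hz.
rewrite key form_valDl (nabla_Gten_horizontal hG (horizontal_stdJ ip cp hx) hyG
  hz).
rewrite (Gten_skew ip cp (nabla_endo _ _ _ _ _))
  (sqr_horizontal ip cp (Gten_sqr ip cp) hy) form_valNr opprK mul_stdJ_Hten.
by rewrite form_valNl mulrN mulNr => E; lra.
Qed.

End NormalContact.

(** * The splitting of the ambient tangent space at a point *)

(* Rad, S, Sp and L are the fibres of Rad TM, S(TM), S(TM^perp) and ltr(TM). *)
Section PointwiseSplitting.
Context {R : fieldType} {m k : nat}.
Variables (g Rad S Sp L : 'M[R]_m) (TM : 'M[R]_(k, m)).
Local Notation b := (form_val g).
Implicit Types x y v w : 'rV[R]_m.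
Hypothesis gC : forall x y, b x y = b y x.
Hypothesis TM_split : (TM :=: Rad + S)%MS.
Hypothesis TM_orth : (orth g TM :=: Rad + Sp)%MS.
Hypothesis Sp_nondeg : nondegenerate_on g Sp.
Hypothesis Rad_Sp : orthogonal_spaces g Rad Sp.
Hypothesis L_S : forall v x, (v <= L)%MS -> (x <= S)%MS -> b v x = 0.
Hypothesis L_Sp : forall v x, (v <= L)%MS -> (x <= Sp)%MS -> b v x = 0.
Hypothesis L_L : forall v x, (v <= L)%MS -> (x <= L)%MS -> b v x = 0.
Hypothesis Rad_L : forall x, (x <= Rad)%MS ->
  (forall v, (v <= L)%MS -> b x v = 0) -> x = 0.

Lemma TM_Sp x y : (x <= TM)%MS -> (y <= Sp)%MS -> b x y = 0.
Proof.
move=> xT yS; rewrite gC; apply: (orthP g TM y).1 xT.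
by rewrite TM_orth (submx_trans yS)// addsmxSr.
Qed.

(** A vector orthogonal to all the summands lies in the orthogonal space of TM,
    which is Rad + Sp. Its Sp part vanishes by nondegeneracy, and then its Rad
    part because L separates Rad. *)
Lemma frame_full : row_full (Sp + (TM + L))%MS.
Proof.
set A := (Sp + _)%MS.
suff : kermx (g *m A^T) == 0.
  rewrite kermx_eq0 -row_leq_rank -col_leq_rank => /leq_trans; apply.
  by rewrite -[X in (_ <= X)%N](mxrank_tr A) mxrankM_maxr.
apply/rowV0P => x; change (x <= orth g A -> x = 0)%MS; move=> /orthP xA.
have xTM : (x <= orth g TM)%MS.
  by apply/orthP => y yT; apply: xA; rewrite /A !(submx_trans yT) ?addsmxSl//
    (submx_trans (addsmxSl _ _) (addsmxSr _ _)).
have xSp y : (y <= Sp)%MS -> b x y = 0.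
  by move=> yS; apply: xA; rewrite (submx_trans yS)// addsmxSl.
have xL y : (y <= L)%MS -> b x y = 0.
  move=> yL; apply: xA; rewrite (submx_trans yL)//.
  exact: (submx_trans (addsmxSr _ _) (addsmxSr _ _)).
move: xTM; rewrite TM_orth => /sub_addsmxP[[A1 A2]] /= xE.
have rR : (A1 *m Rad <= Rad)%MS by exact: submxMl.
have sS : (A2 *m Sp <= Sp)%MS by exact: submxMl.
have s0 : A2 *m Sp = 0.
  apply/eqP; rewrite -submx0 -Sp_nondeg sub_capmx sS /=; apply/orthP => y yS.
  have := xSp y yS; rewrite xE form_valDl.
  by rewrite ((orthP g Sp (A1 *m Rad)).1 (submx_trans rR Rad_Sp) y yS) add0r.
move: xE; rewrite s0 addr0 => xE; rewrite xE; apply: Rad_L => // v vL.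
by rewrite -xE xL.
Qed.

(** TM and L, along which one projects, are orthogonal to Sp. *)
Lemma proj_Sp_form w y : (y <= Sp)%MS -> b (w *m proj_mx Sp (TM + L)%MS) y =
  b w y.
Proof.
move=> yS; have := proj_mx_compl_sub (submx_full w frame_full).
move=> /sub_addsmxP[[A1 A2]] /= E; apply/eqP;
  rewrite eq_sym -subr_eq0 -form_valNl.
rewrite -form_valDl E form_valDl (TM_Sp (submxMl _ _) yS)
  (L_Sp (submxMl _ _) yS).
by rewrite addr0.
Qed.

(** L is orthogonal to S and separates Rad, so it detects the Rad part. *)
Lemma TM_sub_S v : (v <= TM)%MS ->
  (v <= S)%MS <-> (forall y, (y <= L)%MS -> b v y = 0).
Proof.
move=> vT; split=> [vS y yL|vL]; first by rewrite gC L_S.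
move: vT; rewrite TM_split => /sub_addsmxP[[A1 A2]] /= E.
suff r0 : A1 *m Rad = 0 by rewrite E r0 add0r submxMl.
apply: Rad_L => [|y yL]; first exact: submxMl.
by have := vL y yL; rewrite E form_valDl [X in _ + X]gC (L_S yL (submxMl _ _))
  addr0.
Qed.

Variables (F D : 'M[R]_m).
Hypothesis F_isometry : forall x y, (y <= L)%MS -> b (x *m F) (y *m F) = b x y.
Hypothesis Sp_split : (Sp :=: Rad *m F + L *m F + S *m F + D)%MS.
Hypothesis LF_SF : orthogonal_spaces g (Rad *m F + L *m F)%MS (S *m F).
Hypothesis LF_D : orthogonal_spaces g (Rad *m F + L *m F + S *m F)%MS D.

(** F carries the pairing of Rad with L to a pairing of F Rad with F L, while
    F L is orthogonal to itself, to F S and to D. *)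
Lemma RadF_component_eq0 w : (w <= Sp)%MS ->
  w *m proj_mx (Rad *m F) (L *m F + S *m F + D)%MS = 0 <->
  (forall y, (y <= L)%MS -> b w (y *m F) = 0).
Proof.
move=> wS; set pr := w *m _.
have : (w <= Rad *m F + (L *m F + S *m F + D))%MS.
  by rewrite (submx_trans wS)// Sp_split !addsmxA.
move=> /proj_mx_compl_sub; rewrite -/pr => wpr.
have prw y : (y <= L)%MS -> b pr (y *m F) = b w (y *m F).
  move=> yL; have yF : (y *m F <= L *m F)%MS by exact: submxMr.
  have yRL : (y *m F <= Rad *m F + L *m F)%MS.
    by rewrite (submx_trans yF)// addsmxSr.
  apply/eqP; rewrite eq_sym -subr_eq0 -form_valNl -form_valDl.
  case/sub_addsmxP: wpr => -[A A3] /= ->.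
  rewrite form_valDl [X in _ + X]gC.
  rewrite ((orthP g D (y *m F)).1 _ (A3 *m D)) ?submxMl//; last first.
    apply: submx_trans LF_D; rewrite (submx_trans yRL)//.
    by rewrite addsmxSl.
  have : (A *m (L *m F + S *m F)%MS <= L *m F + S *m F)%MS by exact: submxMl.
  move=> /sub_addsmxP[[A1 A2]] /= ->.
  rewrite form_valDl [X in _ + X + _]gC.
  rewrite ((orthP g (S *m F) (y *m F)).1 _ (A2 *m (S *m F))) ?submxMl//;
    last first.
    exact: submx_trans LF_SF.
  by rewrite mulmxA F_isometry// L_L ?submxMl// !addr0.
split=> [pr0 y yL|wL]; first by rewrite -prw// pr0 form_val0l.
have /submxP[A prE] : (pr <= Rad *m F)%MS by exact: proj_mx_sub.
suff A0 : A *m Rad = 0 by rewrite prE mulmxA A0 mul0mx.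
apply: Rad_L => [|y yL]; first exact: submxMl.
by rewrite -(F_isometry _ yL) -mulmxA -prE prw// wL.
Qed.

End PointwiseSplitting.

(** * Screen transversal anti-invariant null submanifolds *)

Lemma christoffel_map_sym (R : realType) m (M : smoothManifold R m)
    (g : chart M -> M -> 'M[R]_m) (c : chart M) p x y w :
  chart_dom c p ->
  (\forall r \near chart_coord c p,
     (g c (chart_inv c r))^T = g c (chart_inv c r)) ->
  g c p \in unitmx -> differentiable (g c \o chart_inv c) (chart_coord c p) ->
  form_val (g c p) (christoffel_map g c p x y) w
  = form_val (g c p) (christoffel_map g c p y x) w.
Proof.
move=> cp gs gu dg.
have gsp : (g c p)^T = g c p.
  by have := nbhs_singleton gs; rewrite coordK.
have sym z y1 w1 : form_val (dir_derive c z (g c) p) y1 w1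
    = form_val (dir_derive c z (g c) p) w1 y1.
  have hd := derivableP (diff_derivable (v := z) dg).
  by rewrite /dir_derive -[in RHS](is_derive_form_sym hd gs) form_val_tr.
by apply: (torsion_free sym) => z y1 w1; exact: koszul.
Qed.

Section JtenFacts.
Context {R : realType} {n q : nat} {Mb : complexContactManifold R n q}.
Variables (a : 'I_3) (i : contact_patch Mb) (c : chart Mb) (p : Mb).
Local Notation m := (cdim n + cdim n)%N.
Local Notation J := (stdJ R (cdim n)).
Local Notation b := (form_val (met c p)).
Local Notation x0 := (chart_coord c p).
Local Notation hor := (horizontal i c p).
Hypotheses (ip : patch_dom i p) (cp : chart_dom c p).

Lemma JtenP :
  [\/ Jten a i = fun _ _ => J, Jten a i = Gten i | Jten a i = Hten i].
Proof.
case: a => [[|[|[|//]]] lta]; [apply: Or31 | apply: Or32 | apply: Or33];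
  by apply/funext => c'; apply/funext => p'; rewrite /Jten (tnth_nth 0).
Qed.

Lemma Jten_differentiable : differentiable (Jten a i c \o chart_inv c) x0.
Proof.
case: JtenP => ->.
- exact: (differentiable_cst J).
- exact: smooth_on_differentiable (smooth_on_patch (Gten_tensor i).1)
  (contact_dom_pt ip cp).
- exact: smooth_on_differentiable (smooth_on_patch (Hten_tensor i).1)
  (contact_dom_pt ip cp).
Qed.

(** J_a is skew, and its square is - 1 on horizontal vectors. *)
Lemma Jten_isometry x y : hor y -> b (x *m Jten a i c p) (y *m Jten a i c p) =
  b x y.
Proof.
move=> hy; case: JtenP => ->.
- by rewrite stdJ_skew// stdJ_stdJ form_valNr opprK.
- by rewrite (Gten_skew ip cp) (sqr_horizontal ip cp (Gten_sqr ip cp) hy)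
  form_valNr opprK.
by rewrite (Hten_skew ip cp) (sqr_horizontal ip cp (Hten_sqr ip cp) hy)
  form_valNr opprK.
Qed.

Hypothesis normal : normal_contact Mb.

(** The formulas for horizontal vectors give 0 for J, and up to sign
    sigma(x) g(G J y, G z) for G and sigma(x) g(G y, G J z) for H. Since G is an
    isometry on horizontal vectors, these are multiples of g(J y, z). *)
Lemma nabla_Jten_orthogonal dF x y z :
  (forall v, is_derive x0 v (Jten a i c \o chart_inv c) (dF v)) ->
  hor x -> hor y -> hor z -> b (y *m J) z = 0 ->
  b (nabla_endo (Jten a i c p) dF (christoffel_map met c p) x y)
    (z *m Jten a i c p) = 0.
Proof.
move=> hF hx hy hz yz; move: hF; case: JtenP => -> hF.
- have -> : dF = fun _ => 0.
    apply/funext => v; apply: (is_derive_near_unique _ (hF v)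
      (is_derive_cst J x0 v)).
    by apply: filterE.
  exact: (nabla_stdJ_horizontal normal ip cp hy (horizontal_stdJ ip cp hz) hx).
- rewrite (nabla_Gten_horizontal normal ip cp hF hy (horizontal_Gten ip cp z)
  hx).
  rewrite -(mul_stdJ_Gten ip cp y) (Gten_skew ip cp).
  by rewrite (sqr_horizontal ip cp (Gten_sqr ip cp) hz) form_valNr yz !oppr0
    mulr0.
rewrite -(mul_stdJ_Gten ip cp z).
rewrite (nabla_Hten_horizontal normal ip cp hF hy (horizontal_Gten ip cp _) hx).
rewrite (Gten_skew ip cp) (sqr_horizontal ip cp (Gten_sqr ip cp)
  (horizontal_stdJ ip cp hz)).
by rewrite form_valNr opprK -[b y _]opprK -stdJ_skew// yz oppr0 mulr0.
Qed.

End JtenFacts.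

Section ScreenTransversal.
Context {R : realType} {n q k r : nat} {Mb : complexContactManifold R n q}.
Variables (M : nullSubmanifold Mb k r).
Local Notation m := (cdim n + cdim n)%N.
Local Notation f := (sub_incl M).
Local Notation J := (stdJ R (cdim n)).
Variables (e : chart M) (c : chart Mb) (p : M).
Hypotheses (ep : chart_dom e p) (cp : chart_dom c (f p)).
Local Notation b := (form_val (met c (f p))).
Local Notation TM := (tangent_map f e c p).

Lemma vector_field_derivable (X : chart M -> M -> 'rV[R]_k) :
  vector_field setT X -> forall x, derivable (X e \o chart_inv e)
    (chart_coord e p) x.
Proof.
move=> [sX _] x; apply/diff_derivable;
  apply: smooth_on_differentiable (sX e e) _.
by exists p.
Qed.

Lemma dir_derive_Jpush a i (Y : chart M -> M -> 'rV[R]_k) x :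
  patch_dom i (f p) -> vector_field setT Y ->
  dir_derive e x (Jpush a i Y e c) p =
  dir_derive e x (push Y e c) p *m Jten a i c (f p)
  + push Y e c p *m dir_derive c (x *m TM) (Jten a i c) (f p).
Proof.
move=> ip vY.
have hY := is_derive_push (sub_incl_smooth M) ep cp
  (@vector_field_derivable _ vY x).
have hF := is_derive_pullback (sub_incl_smooth M) x ep cp
  (Jten_differentiable a ip cp).
have at_p (W : Type) (h : M -> W) : (h \o chart_inv e) (chart_coord e p) = h p.
  by rewrite /= coordK.
have [_ Ey] := hY.
have [_] := is_derive_mulmx hY hF.
by rewrite -Ey !at_p => E; exact: E.
Qed.

(** Along M the derivative of J_a is the ambient one, by the chain rule, and the
    antisymmetrized derivative of the push-forwards is the bracket. The rest is
    a regrouping of the Christoffel terms into covariant derivatives of J_a. *)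
Lemma nabla_Jpush_bracket a i (X Y : chart M -> M -> 'rV[R]_k) :
  patch_dom i (f p) -> vector_field setT X -> vector_field setT Y ->
  let F := Jten a i c (f p) in
  let dF v := dir_derive c v (Jten a i c) (f p) in
  let Gam := christoffel_map met c (f p) in
  let x := push X e c p in let y := push Y e c p in
  nabla met f e c (X e p) (Jpush a i Y e c) p
  - nabla met f e c (Y e p) (Jpush a i X e c) p =
  (lie_bracket e (X e) (Y e) p *m TM + (Gam x y - Gam y x)) *m F
  + (nabla_endo F dF Gam x y - nabla_endo F dF Gam y x).
Proof.
move=> ip vX vY F dF Gam x y.
rewrite /nabla !dir_derive_Jpush// -/(christoffel_map _ _ _ _ _)
  -/(christoffel_map _ _ _ _ _).
rewrite -(push_bracket (sub_incl_smooth M) ep cp (vector_field_derivable vX)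
  (vector_field_derivable vY)).
rewrite /Jpush -/F -/(push X e c p) -/(push Y e c p) -/x -/y -/Gam.
rewrite -/(push X e c) -/(push Y e c) /nabla_endo.
move: (dir_derive e _ _ p) (dir_derive e _ _ p) => dY dX.
rewrite -/(dF x) -/(dF y) mulmxDl !mulmxBl.
move: (dY *m F) (dX *m F) (y *m dF x) (x *m dF y) (Gam x y *m F) (Gam y x *m F)
  (Gam x (y *m F)) (Gam y (x *m F)) => v1 v2 v3 v4 v5 v6 v7 v8.
by apply/rowP => l; rewrite !mxE; ring.
Qed.

Hypothesis hM : screen_transversal_anti_invariant M.
Variable i : contact_patch Mb.
Hypothesis ip : patch_dom i (f p).

Lemma sub_formC x y : b x y = b y x.
Proof. exact: met_formC. Qed.

Lemma STM_sub_TM : (STM c p <= TM)%MS.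
Proof. by have [_ -> _ _] := STM_screen ep cp; exact: addsmxSr. Qed.

Lemma horizontal_of_orth x : (forall y, (y <= STMperp c p)%MS -> b x y = 0) ->
  horizontal i c (f p) x.
Proof.
move=> xS; apply/(horizontalP i cp).
have [UV _ _ _] := hM ip cp.
split; rewrite sub_formC xS// (submx_trans _ UV)// ?addsmxSl ?addsmxSr//.
Qed.

Lemma STM_STMperp x y : (x <= STM c p)%MS -> (y <= STMperp c p)%MS -> b x y = 0.
Proof.
move=> xS; have [_ TMo _ _] := STMperp_screen ep cp.
exact: (TM_Sp sub_formC TMo (submx_trans xS STM_sub_TM)).
Qed.

(** The frames xi of Rad TM and N of ltr(TM) are dual to each other, and the N_j
    are null and orthogonal to S(TM) and S(TM^perp). *)
Lemma ltr_pairings :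
  [/\ forall v x, (v <= ltrTM c p)%MS -> (x <= STM c p)%MS -> b v x = 0,
      forall v x, (v <= ltrTM c p)%MS -> (x <= STMperp c p)%MS -> b v x = 0,
      forall v x, (v <= ltrTM c p)%MS -> (x <= ltrTM c p)%MS -> b v x = 0 &
      forall x, (x <= RadTM c p)%MS ->
        (forall v, (v <= ltrTM c p)%MS -> b x v = 0) -> x = 0].
Proof.
case: (@ltrTM_def _ _ _ _ _ _ M p) => O [_ Op [xi [N [_ /(_ c p Op cp)]]]].
move=> [xiE NE NS xiN NN].
have form_rows (A : 'I_r -> 'rV[R]_m) (u : 'rV[R]_r) y :
    b (u *m (\matrix_(j < r) A j)) y = \sum_j u 0 j * b (A j) y.
  rewrite mulmx_sum_row /form_val !mulmx_suml summxE.
  by apply: eq_bigr => j _; rewrite rowK -!scalemxAl mxE.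
have NO (B : 'M[R]_m) : (forall j, N j c p <= orth (met c (f p)) B)%MS ->
    forall v x, (v <= ltrTM c p)%MS -> (x <= B)%MS -> b v x = 0.
  move=> NB v x; rewrite -NE => /submxP[u ->] xB;
    rewrite form_rows big1// => j _.
  by rewrite ((orthP _ _ _).1 (NB j))// mulr0.
split.
- by apply: NO => j; have := NS j; rewrite sub_capmx => /andP[].
- by apply: NO => j; have := NS j; rewrite sub_capmx => /andP[].
- move=> v x; rewrite -!NE => /submxP[u ->] /submxP[u' ->].
  rewrite form_rows big1// => j _; rewrite sub_formC form_rows big1 ?mulr0// =>
    j' _.
  by rewrite NN mulr0.
move=> x; rewrite -xiE => /submxP[u ->] uN.
suff -> : u = 0 by rewrite mul0mx.
apply/rowP => j; rewrite [RHS]mxE.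
have := uN (N j c p).
rewrite -NE => /(_ _)/wrap[].
  by rewrite -[N j c p](rowK (fun j => N j c p)) row_sub.
rewrite form_rows (bigD1 j)//= xiN eqxx mulr1 big1 ?addr0// => j' jj'.
by rewrite xiN (negPf jj') mulr0.
Qed.

Hypothesis normal : normal_contact Mb.
Variables (a : 'I_3) (X Y : chart M -> M -> 'rV[R]_k).
Hypotheses (sX : screen_section X) (sY : screen_section Y).

Lemma horizontal_STM x : (x <= STM c p)%MS -> horizontal i c (f p) x.
Proof. by move=> xS; apply: horizontal_of_orth => y; exact: STM_STMperp. Qed.

Lemma horizontal_ltr x : (x <= ltrTM c p)%MS -> horizontal i c (f p) x.
Proof.
by move=> xL; apply: horizontal_of_orth => y; have [_ + _ _] := ltr_pairings;
  exact.
Qed.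

(** The terms with a covariant derivative of J_a vanish, the two Christoffel
    terms agree by symmetry, and J_a is an isometry. This is where the normality
    of the ambient manifold enters. *)
Lemma bracket_ltr z : (z <= ltrTM c p)%MS ->
  b (nabla met f e c (X e p) (Jpush a i Y e c) p
     - nabla met f e c (Y e p) (Jpush a i X e c) p) (z *m Jten a i c (f p))
  = b (lie_bracket e (X e) (Y e) p *m TM) z.
Proof.
move=> zL; have [[vX STX] [vY STY]] := (sX, sY).
have xS := STX e c p ep cp; have yS := STY e c p ep cp.
have hz := horizontal_ltr zL.
have [hx hy] := (horizontal_STM xS, horizontal_STM yS).
have [_ _ SJ _] := hM ip cp; have [_ LSp _ _] := ltr_pairings.
have Jz u : (u <= STM c p)%MS -> b (u *m J) z = 0.
  move=> uS; rewrite sub_formC LSp// (submx_trans _ (SJ ord0))//.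
  by rewrite /Jten (tnth_nth 0) submxMr.
have hF v : is_derive (chart_coord c (f p)) v (Jten a i c \o chart_inv c)
    (dir_derive c v (Jten a i c) (f p)).
  exact: derivableP (diff_derivable (Jten_differentiable a ip cp)).
rewrite nabla_Jpush_bracket// form_valDl [X in _ + X]form_valDl form_valNl.
rewrite (nabla_Jten_orthogonal ip cp normal hF hx hy hz (Jz _ yS)).
rewrite (nabla_Jten_orthogonal ip cp normal hF hy hx hz (Jz _ xS)) oppr0 !addr0.
rewrite (Jten_isometry _ ip cp _ hz) form_valDl [X in _ + X]form_valDl
  form_valNl.
rewrite (christoffel_map_sym _ _ _ cp) ?subrr ?addr0//.
- apply: filterS (open_nbhs_nbhs (conj (@contact_dom_open _ _ _ _ i c)
    (contact_dom_pt ip cp))) => v /contact_domP[_ cv].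
  exact: met_sym.
- exact: met_nondeg.
exact: smooth_on_differentiable (@smooth_met _ _ _ _ i c)
  (contact_dom_pt ip cp).
Qed.

(** The vectors J_a N, with N in ltr(TM), detect the J_a Rad TM component and do
    not see the projection to S(TM^perp); the vectors N detect whether a tangent
    vector lies in the screen. By [bracket_ltr] both tests are the same. *)
Lemma JRad_component_eq0 (D0 : contact_patch Mb -> chart Mb -> M -> 'M[R]_m) :
  transversal_decomposition a D0 ->
  JRad_component a D0 i c p
    (nabla_s e c (X e p) (Jpush a i Y e c) p
     - nabla_s e c (Y e p) (Jpush a i X e c) p) = 0 <->
  (lie_bracket e (X e) (Y e) p *m TM <= STM c p)%MS.
Proof.
move=> hD0; have [SpE _ [LF_SF LF_D] _ _] := hD0 i c p ip cp.
have [_ _ _ SJL] := hM ip cp; have [LS LSp LL RL] := ltr_pairings.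
have [_ TME _ _] := STM_screen ep cp.
have [Spn TMo _ RSp] := STMperp_screen ep cp.
have iso x y : (y <= ltrTM c p)%MS ->
    b (x *m Jten a i c (f p)) (y *m Jten a i c (f p)) = b x y.
  by move=> yL; rewrite (Jten_isometry _ ip cp _ (horizontal_ltr yL)).
rewrite /JRad_component /nabla_s -mulmxBl.
set w := nabla _ _ _ _ _ _ _ - _.
rewrite (RadF_component_eq0 sub_formC LL RL iso SpE LF_SF LF_D
  (proj_mx_sub _ _ _)).
rewrite (TM_sub_S sub_formC TME LS RL (submxMl _ _)).
have E z : (z <= ltrTM c p)%MS ->
    b (w *m proj_mx (STMperp c p) (TM + ltrTM c p)%MS) (z *m Jten a i c (f p))
    = b (lie_bracket e (X e) (Y e) p *m TM) z.
  move=> zL; rewrite (proj_Sp_form sub_formC TMo Spn RSp LSp RL).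
    exact: bracket_ltr.
  by rewrite (submx_trans _ (SJL a))// submxMr.
by split=> H z zL; [rewrite -E// H | rewrite E// H].
Qed.

End ScreenTransversal.

Theorem theorem5p4 (R : realType) (n q k r : nat) (hq : (0 < q)%N) (hqn : (q < n)%N)
    (Mb : complexContactManifold R n q) (M : nullSubmanifold Mb k r)
    (hnormal : normal_contact Mb) (hM : screen_transversal_anti_invariant M)
    (a : 'I_3) (D0 : contact_patch Mb -> chart Mb -> M -> 'M[R]_(cdim n + cdim n))
    (hD0 : transversal_decomposition a D0) :
  screen_integrable M <->
  forall X Y : chart M -> M -> 'rV[R]_k,
    screen_section X -> screen_section Y ->
    forall (i : contact_patch Mb) (e : chart M) (c : chart Mb) (p : M),
      patch_dom i (sub_incl M p) -> chart_dom e p -> chart_dom c (sub_incl M p) ->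
      JRad_component a D0 i c p
        (nabla_s e c (X e p) (Jpush a i Y e c) p
         - nabla_s e c (Y e p) (Jpush a i X e c) p) = 0.
Proof.
split=> [SI X Y sX sY i e c p ip ep cp | JR X Y sX sY e c p ep cp].
  apply/(JRad_component_eq0 ep cp hM ip hnormal sX sY hD0).
  exact: SI.
have [i ip] := pdom_cover (sub_incl M p).
apply/(JRad_component_eq0 ep cp hM ip hnormal sX sY hD0).
exact: JR.
Qed.
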